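(* Let $p=p(n)$ satisfy $0<p\le 1$. (a) If $n^2p\to\infty$ and $np\le 1+o(1)$, then $q^*(G_{n,p})\to 1$ in probability. (b) Given constants $1<c_0\le c_1$, there exists $\delta=\delta(c_0,c_1)>0$ such that, if $c_0\le np\le c_1$ for all sufficiently large $n$, then with high probability $\delta<q^*(G_{n,p})<1-\delta$. (c) If $np\to\infty$, then $q^*(G_{n,p})\to 0$ in probability.
   Context: For a graph $G$ with $m\ge 1$ edges and a partition $\mathcal A$ of its vertex set, the modularity score is $q_{\mathcal A}(G)=\frac1m\sum_{A\in\mathcal A}e(A)-\frac{1}{4m^2}\sum_{A\in\mathcal A}\mathrm{vol}(A)^2$, where $e(A)$ is the number of edges with both ends in $A$ and $\mathrm{vol}(A)=\sum_{v\in A}d_v$ is the sum of degrees. The modularity is $q^*(G)=\max_{\mathcal A}q_{\mathcal A}(G)$ over all vertex partitions; by convention $q^*(G)=0$ if $G$ has no edges. $G_{n,p}$ is the Erdős–Rényi random graph on vertex set $[n]$ where each of the $\binom n2$ possible edges appears independently with probability $p$. ''With high probability'' (whp) means with probability tending to $1$ as $n\to\infty$; $X_n\to a$ in probability means that for each $\varepsilon>0$, $|X_n-a|<\varepsilon$ whp. *)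

(* Defs.v *)
From HB Require Import structures.
From mathcomp Require Import all_boot all_order all_algebra.
From mathcomp Require Import all_classical all_reals all_analysis.

Set Implicit Arguments.
Unset Strict Implicit.
Unset Printing Implicit Defensive.

Import Order.TTheory GRing.Theory Num.Theory.
Import numFieldNormedType.Exports.

Local Open Scope ring_scope.

Section SimpleGraphs.
Variable T : finType.

Record sgraph := SGraph {
  edges :> {set {set T}};
  _ : [forall e in edges, #|e| == 2%N] }.

HB.instance Definition _ := [isSub for edges].
HB.instance Definition _ := [Finite of sgraph by <:].

Implicit Types (G : sgraph) (A : {set T}) (P : {set {set T}}).

Definition n_edges G : nat := #|edges G|.

Definition degree G (v : T) : nat := #|[set e in edges G | v \in e]%SET|.

Definition edges_within G A : nat := #|[set e in edges G | e \subset A]%SET|.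

Definition vol G A : nat := (\sum_(v in A) degree G v)%N.

Variable R : realType.

Definition modularity_score G P : R :=
  (n_edges G)%:R^-1 * (\sum_(A in P) (edges_within G A)%:R)
  - (4 * (n_edges G)%:R ^+ 2)^-1 * (\sum_(A in P) (vol G A)%:R ^+ 2).

(* [finset.partition] excludes empty blocks.  The starting value of the iterated
   maximum is the score of the one-block partition; as soon as [T] is nonempty
   it is itself one of the scores being compared. *)
Definition modularity G : R :=
  if n_edges G == 0%N then 0 else
  \big[Num.max / modularity_score G [set [set: T]]%SET]_(P : {set {set T}}
     | finset.partition P [set: T]%SET) modularity_score G P.

End SimpleGraphs.

Section RandomGraph.
Variable R : realType.

(* The law of $G_{n,p}$ is the product over the unordered pairs [e] of vertices
   of Bernoulli([p]) laws for the presence of [e]. *)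
Definition Gnp_mass (n : nat) (p : R) (G : sgraph 'I_n) : R :=
  \prod_(e : {set 'I_n} | #|e| == 2%N) (if e \in edges G then p else 1 - p).

Definition Gnp_prob (n : nat) (p : R) (E : pred (sgraph 'I_n)) : R :=
  \sum_(G : sgraph 'I_n | E G) Gnp_mass p G.

Definition whp (p : nat -> R) (E : forall n, pred (sgraph 'I_n)) : Prop :=
  ((fun n => Gnp_prob (p n) (E n)) @ \oo --> (1 : R))%classic.

Definition cvg_in_prob (p : nat -> R) (X : forall n, sgraph 'I_n -> R)
    (a : R) : Prop :=
  forall eps : R, 0 < eps -> whp p (fun n G => `|X n G - a| < eps).

End RandomGraph.

Arguments modularity {T} R G.

(* Main.v *)
Require Import Defs.
From HB Require Import structures.
From mathcomp Require Import all_boot all_order all_algebra.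
From mathcomp Require Import reals sequences exp.
From mathcomp Require Import ring lra zify.

Set Implicit Arguments.
Unset Strict Implicit.
Unset Printing Implicit Defensive.

Import Order.TTheory GRing.Theory Num.Theory.

Local Open Scope ring_scope.

(* Lower bounds: write $G_{n,p}$ as the union of a subcritical graph $S = G_{n,\kappa p}$
   and an independent sprinkled graph, and partition the vertices into the components of
   $S$.  About a proportion $\kappa$ of the edges is inside the parts, and the expected
   value of $\sum_u d_u^2 |C_S(u)|$, which bounds the sum of the squared volumes, is
   $O(n^2 p)$, negligible against $m^2$; so $q^* \ge \kappa - o(1)$.  In (a), $\kappa$ is
   close to 1; in (b), $\kappa = 1/(2 c_1)$.
   Upper bound in (b): if $q^* > 1 - r^2$ then deleting at most $r^2 m$ edges leaves
   components of size at most $1 + 2 r m$.  For the supercritical $G_{n,p}$ itself, having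
   only such small components has probability exponentially small in $n$ (an exponential
   supermartingale along a graph search), and putting back the deleted edges costs a
   factor which is subexponential in comparison when $r$ is small.
   Upper bound in (c): in a random union $U$ of parts, the mean of
   $e(U)/m - vol(U)^2/(4m^2)$ is a quarter of the modularity score, while Chernoff's
   inequality makes this quantity small for all $2^n$ sets $U$ at once. *)

(** * Random subsets of a finite type *)

Section RandomSubset.
Variables (R : realFieldType) (I : finType).
Implicit Types (P : I -> R) (A B D F : {set I}).

(** Law of a random subset with independent memberships. The probability may vary with the element,
    so that a random edge set can be a random subset of all vertex sets, those that are not pairs
    having probability 0. *)
Definition bmass P A : R := \prod_i (if i \in A then P i else 1 - P i).

Definition expct P (f : {set I} -> R) : R := \sum_A bmass P A * f A.

Definition prob P (E : pred {set I}) : R := expct P (fun A => (E A)%:R).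

Lemma eq_expct P f g : f =1 g -> expct P f = expct P g.
Proof. by move=> fg; apply: eq_bigr => A _; rewrite fg. Qed.

(** Independence: expanding a product over [i] of two-term sums gives one term for each subset. Most
    laws below are computed by bringing an event into this product form. *)
Lemma expct_prod P g h :
  expct P (fun A => \prod_i (if i \in A then g i else h i)) =
  \prod_i (P i * g i + (1 - P i) * h i).
Proof.
rewrite bigA_distr /expct; apply: eq_bigr => A _.
by rewrite /bmass -big_split; apply: eq_bigr => i _; case: ifP.
Qed.

Lemma expctD P f g : expct P (fun A => f A + g A) = expct P f + expct P g.
Proof. by rewrite /expct -big_split; apply: eq_bigr => A _; rewrite mulrDr. Qed.

Lemma expctZ P c f : expct P (fun A => c * f A) = c * expct P f.
Proof. by rewrite /expct big_distrr; apply: eq_bigr => A _ /=; rewrite mulrCA. Qed.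

Lemma expct_sum P (J : finType) (Q : pred J) (f : J -> {set I} -> R) :
  expct P (fun A => \sum_(j | Q j) f j A) = \sum_(j | Q j) expct P (f j).
Proof.
rewrite /expct exchange_big /=; apply: eq_bigr => A _.
by rewrite big_distrr.
Qed.

Lemma expct_bmass1 P : \sum_A bmass P A = 1.
Proof.
rewrite (eq_bigr (fun A => bmass P A * 1)) => [|A _]; last by rewrite mulr1.
transitivity (expct P (fun A => \prod_i (if i \in A then 1 else 1))).
  by apply: eq_bigr => A _; rewrite big1 // => i _; case: ifP.
by rewrite expct_prod big1 // => i _; rewrite !mulr1 addrC subrK.
Qed.

Lemma expct_cst P c : expct P (fun=> c) = c.
Proof. by rewrite /expct -big_distrl /= expct_bmass1 mul1r. Qed.

(* Reduces comparisons of laws to singletons, where they factorize. *)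
Lemma pointE (f : {set I} -> R) A : f A = \sum_B f B * (A == B)%:R.
Proof.
by rewrite (bigD1 A) //= eqxx mulr1 big1 ?addr0 // => B; rewrite eq_sym => /negPf ->; rewrite mulr0.
Qed.

Lemma eq_setI_prod A B D :
  ((A :&: D == B)%:R : R) =
  \prod_i (if i \in A then ((i \in D) == (i \in B))%:R else (i \notin B)%:R).
Proof.
case: eqP => [/setP e|/eqP ne].
  rewrite big1 // => i _; move: (e i); rewrite inE.
  by case: (i \in A) => /= <-; rewrite ?eqxx.
have [i ni] : exists i, (i \in A :&: D) != (i \in B).
  apply/existsP; rewrite -[X in is_true X]negbK negb_exists; apply: contra ne.
  by move/forallP=> h; apply/eqP/setP => i; have := h i; rewrite negbK => /eqP.
rewrite (bigD1 i) //= (_ : (if _ then _ else _) = 0) ?mul0r //.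
by move: ni; rewrite inE; case: (i \in A) => /=; [move/negPf-> | case: (i \in B)].
Qed.

(** The traces of the random set on [D] and on its complement are independent, so the second may be
    resampled. By linearity it is enough to compare point masses, and these factorize. *)
Lemma expct_split P D (F : {set I} -> {set I} -> R) :
  expct P (fun A => F (A :&: D) (A :\: D)) =
  expct P (fun A => expct P (fun B => F (A :&: D) (B :\: D))).
Proof.
have pt X Y : F X Y = \sum_X' \sum_Y' F X' Y' * ((X == X')%:R * (Y == Y')%:R).
  rewrite (pointE (fun X => F X Y)); apply: eq_bigr => X' _.
  rewrite (pointE (F X')) big_distrl; apply: eq_bigr => Y' _ /=.
  by rewrite mulrAC mulrA.
transitivity (\sum_X \sum_Y F X Y * (expct P (fun A => (A :&: D == X)%:R)
   * expct P (fun A => (A :\: D == Y)%:R))).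
  under eq_expct => A do rewrite pt.
  rewrite expct_sum; apply: eq_bigr => X _.
  rewrite expct_sum; apply: eq_bigr => Y _.
  rewrite expctZ; congr (_ * _).
  have E (g1 h1 g2 h2 : I -> R) A :
    \prod_i (if i \in A then g1 i else h1 i) * \prod_i (if i \in A then g2 i else h2 i) =
    \prod_i (if i \in A then g1 i * g2 i else h1 i * h2 i).
    by rewrite -big_split; apply: eq_bigr => i _ /=; case: ifP.
  under eq_expct => A do rewrite setDE !eq_setI_prod E.
  under [X in _ = X * _]eq_expct => A do rewrite eq_setI_prod.
  under [X in _ = _ * X]eq_expct => A do rewrite setDE eq_setI_prod.
  rewrite !expct_prod -big_split; apply: eq_bigr => i _ /=.
  by rewrite !inE; case: (i \in D); case: (i \in X); case: (i \in Y) => /=; ring.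
apply/esym.
transitivity (expct P (fun A => \sum_X \sum_Y (F X Y *
    expct P (fun B => (B :\: D == Y)%:R)) * (A :&: D == X)%:R)).
  apply: eq_expct => A.
  under eq_expct => B do rewrite pt.
  rewrite expct_sum; apply: eq_bigr => X _.
  rewrite expct_sum; apply: eq_bigr => Y _.
  under eq_expct => B do rewrite mulrA.
  by rewrite expctZ mulrAC.
rewrite expct_sum; apply: eq_bigr => X _.
rewrite expct_sum; apply: eq_bigr => Y _.
by rewrite expctZ; ring.
Qed.

End RandomSubset.

(** * Monotonicity, moments and tail bounds for random subsets *)

Section Bounds.
Variables (R : realFieldType) (I : finType) (P : I -> R).
Hypothesis P01 : forall i, 0 <= P i <= 1.
Implicit Types (A B D F : {set I}) (E : pred {set I}).

Lemma bmass_ge0 A : 0 <= bmass P A.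
Proof.
apply: prodr_ge0 => i _; have /andP[P0 P1] := P01 i.
by case: ifP => _ //; rewrite subr_ge0.
Qed.

(** The comparison is asked on the support only, so that edge sets containing something other than a
    pair can be discarded. *)
Lemma le_expct f g :
  (forall A, bmass P A != 0 -> f A <= g A) -> expct P f <= expct P g.
Proof.
move=> fg; apply: ler_sum => A _; have [->|nz] := eqVneq (bmass P A) 0.
  by rewrite !mul0r.
by rewrite ler_wpM2l ?bmass_ge0 ?fg.
Qed.

Lemma expct_ge0 f : (forall A, 0 <= f A) -> 0 <= expct P f.
Proof. by move=> f0; rewrite -(expct_cst P 0); apply: le_expct. Qed.

Lemma expct_split_le D (f : {set I} -> {set I} -> R) (phi : {set I} -> R) :
  (forall X : {set I}, X \subset D -> expct P (fun B => f X (B :\: D)) <= phi X) ->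
  expct P (fun A => f (A :&: D) (A :\: D)) <= expct P (fun A => phi (A :&: D)).
Proof.
by move=> fphi; rewrite expct_split; apply: le_expct => A _; apply/fphi/subsetIr.
Qed.

Lemma le_prob E E' : (forall A, bmass P A != 0 -> E A -> E' A) -> prob P E <= prob P E'.
Proof.
move=> EE'; apply: le_expct => A nz; rewrite ler_nat.
by case EA: (E A) => //; rewrite EE'.
Qed.

Lemma prob_ge0 E : 0 <= prob P E.
Proof. by apply: expct_ge0. Qed.

Lemma prob_le1 E : prob P E <= 1.
Proof. by rewrite -[leRHS](expct_cst P); apply: le_expct => A _; case: (E A). Qed.

Lemma probU E E' : prob P (fun A => E A || E' A) <= prob P E + prob P E'.
Proof.
by rewrite /prob -expctD; apply: le_expct => A _; case: (E A); case: (E' A) => /=; lra.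
Qed.

Lemma prob_exists (J : finType) (Q : pred J) (E : J -> pred {set I}) :
  prob P (fun A => [exists j, Q j && E j A]) <= \sum_(j | Q j) prob P (E j).
Proof.
rewrite /prob -expct_sum; apply: le_expct => A _; case: existsP => [[j /andP[Qj Ej]]|_].
  by rewrite (bigD1 j) //= Ej lerDl sumr_ge0.
by rewrite sumr_ge0.
Qed.

Lemma markov_prob (f : {set I} -> R) (c : R) :
  0 < c -> (forall A, 0 <= f A) -> prob P (fun A => c <= f A) <= expct P f / c.
Proof.
move=> c0 f0; rewrite ler_pdivlMr // mulrC -expctZ; apply: le_expct => A _.
by case: (leP c (f A)) => h /=; rewrite ?mulr1 ?mulr0.
Qed.

Lemma expct_expcard x D :
  expct P (fun A => x ^+ #|A :&: D|) = \prod_(i in D) (1 - P i + P i * x).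
Proof.
transitivity (expct P (fun A => \prod_i (if i \in A then if i \in D then x else 1 else 1))).
  apply: eq_expct => A; rewrite -prodr_const [LHS]big_mkcond; apply: eq_bigr => i _.
  by rewrite inE; case: (i \in A); case: (i \in D).
rewrite expct_prod [RHS]big_mkcond; apply: eq_bigr => i _.
by case: ifP => _; ring.
Qed.

Lemma prob_subset D : prob P (fun A => D \subset A) = \prod_(i in D) P i.
Proof.
transitivity (expct P (fun A => \prod_i (if i \in A then 1 else (i \notin D)%:R))).
  apply: eq_expct => A; case: subsetP => [DA|nDA].
    rewrite big1 // => i _; case: ifP => // /negbT iA.
    by case iD: (i \in D) => //; rewrite DA in iA.
  have [i iD iA] : exists2 i, i \in D & i \notin A.
    by apply/subsetPn; apply/negP => /subsetP.
  by rewrite (bigD1 i) //= (negPf iA) iD mul0r.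
rewrite expct_prod [RHS]big_mkcond; apply: eq_bigr => i _.
by case: (i \in D); rewrite /= ?mulr1n; ring.
Qed.

Lemma cardI_sum A D : (#|A :&: D|%:R : R) = \sum_(i in D) (i \in A)%:R.
Proof.
rewrite -sum1_card natr_sum [RHS]big_mkcond [LHS]big_mkcond.
by apply: eq_bigr => i _; rewrite inE; case: (i \in A); case: (i \in D).
Qed.

Lemma expct_mem i : expct P (fun A => (i \in A)%:R) = P i.
Proof.
have := prob_subset [set i]; rewrite big_set1 => <-.
by apply: eq_expct => A; rewrite sub1set.
Qed.

Lemma expct_cardI D : expct P (fun A => #|A :&: D|%:R) = \sum_(i in D) P i.
Proof.
under eq_expct => A do rewrite cardI_sum.
by rewrite expct_sum; apply: eq_bigr => i _; rewrite expct_mem.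
Qed.

(** Expand the square over pairs [(i, j)]: distinct pairs contribute [P i * P j] by independence,
    and the diagonal contributes the mean. *)
Lemma expct_cardI_sqr D :
  expct P (fun A => #|A :&: D|%:R ^+ 2) <= (\sum_(i in D) P i) ^+ 2 + \sum_(i in D) P i.
Proof.
have -> : expct P (fun A => #|A :&: D|%:R ^+ 2) =
    \sum_(i in D) \sum_(j in D) prob P (fun A => [set i; j] \subset A).
  rewrite -(eq_bigr _ (fun i _ => expct_sum P _ _)) -expct_sum.
  apply: eq_expct => A; rewrite cardI_sum expr2 big_distrl; apply: eq_bigr => i _.
  rewrite big_distrr; apply: eq_bigr => j _ /=.
  by rewrite subUset !sub1set; case: (i \in A); case: (j \in A); rewrite /= ?mulr1 ?mulr0.
rewrite expr2 big_distrl -big_split; apply: ler_sum => i iD /=.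
rewrite [leLHS](bigD1 i) //= setUid prob_subset big_set1 addrC lerD2r.
rewrite (bigD1 i iD) /= mulrDr ler_wpDl //.
  by have /andP[P0 _] := P01 i; rewrite mulr_ge0.
rewrite big_distrr; apply: ler_sum => j /andP[_ ji] /=.
by rewrite prob_subset big_setU1 ?big_set1 // inE eq_sym.
Qed.

(** Chebyshev's inequality; the variance of the count is at most its mean. *)
Lemma chebyshev_cardI D (e : R) : 0 < e ->
  prob P (fun A => e <= `|#|A :&: D|%:R - \sum_(i in D) P i|) <= (\sum_(i in D) P i) / e ^+ 2.
Proof.
move=> e0; set mu := \sum_(i in D) P i; pose X A : R := #|A :&: D|%:R.
apply: (@le_trans _ _ (expct P (fun A => (X A - mu) ^+ 2) / e ^+ 2)).
  apply: le_trans (markov_prob _ _); rewrite ?exprn_gt0 //; last by move=> A; apply: sqr_ge0.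
  by apply: le_prob => A _ h; rewrite -[leRHS]real_normK ?num_real // lerXn2r ?nnegrE // ltW.
rewrite ler_wpM2r ?invr_ge0 ?sqr_ge0 //.
have -> : expct P (fun A => (X A - mu) ^+ 2) =
    expct P (fun A => X A ^+ 2) + (- (2 * mu) * expct P X + mu ^+ 2).
  rewrite -expctZ -[X in _ + (_ + X)](expct_cst P) -!expctD; apply: eq_expct => A; ring.
have := expct_cardI_sqr D; rewrite expct_cardI -/mu -/X; lra.
Qed.

(* Moving from [A] to [A :\: F] costs the likelihood ratio of [F]. *)
Lemma prob_setD (E : pred {set I}) F : (forall i, P i < 1) ->
  prob P (fun A => (F \subset A) && E (A :\: F)) <= prob P E * \prod_(i in F) (P i / (1 - P i)).
Proof.
move=> P1; set r := \prod_(i in F) _.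
have mE A : F \subset A -> bmass P A = r * bmass P (A :\: F).
  move=> FA; rewrite /r big_mkcond -big_split; apply: eq_bigr => i _ /=.
  rewrite inE; case iF: (i \in F); rewrite /= ?mul1r // (subsetP FA _ iF).
  by rewrite divfK // gt_eqF // subr_gt0.
have r0 : 0 <= r.
  by apply: prodr_ge0 => i _; have /andP[? ?] := P01 i; rewrite divr_ge0 // subr_ge0.
rewrite mulrC -expctZ.
have -> : prob P (fun A => (F \subset A) && E (A :\: F)) =
   \sum_(A : {set I} | F \subset A) r * (bmass P (A :\: F) * (E (A :\: F))%:R).
  rewrite /prob /expct [RHS]big_mkcond; apply: eq_bigr => A _.
  by case FA: (F \subset A); rewrite /= ?mulr0 // mE // mulrA.
(* Substitute [A = B :|: F] with [B] disjoint from [F]; on the right-hand side the sets [B] that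
   meet [F] are dropped by nonnegativity. *)
rewrite (reindex_onto (fun B => B :|: F) (fun A => A :\: F)) /=; last first.
  by move=> A FA; rewrite setUC setDE setUIr setUCr setIT; apply/setUidPr.
rewrite /expct [leLHS]big_mkcond; apply: ler_sum => B _.
case: ifP => [/andP[_ /eqP->]|_]; first by rewrite mulrCA.
by rewrite mulr_ge0 ?bmass_ge0 // mulr_ge0.
Qed.

End Bounds.

(** Sprinkling: an element is absent from the union of two independent random sets exactly when it
    is absent from both, whence the product of the absence probabilities. *)
Lemma expct_setU (R : realFieldType) (I : finType) (P P1 P2 : I -> R) f :
  (forall i, 1 - P i = (1 - P1 i) * (1 - P2 i)) ->
  expct P f = expct P1 (fun A => expct P2 (fun B => f (A :|: B))).
Proof.
move=> PE.
transitivity (\sum_X f X * bmass P X).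
  by apply: eq_bigr => X _; rewrite mulrC.
under [RHS]eq_expct => A.
  under eq_expct => B do rewrite pointE.
  rewrite expct_sum; under eq_bigr => X _ do rewrite expctZ.
  over.
rewrite expct_sum; apply: eq_bigr => X _; rewrite expctZ; congr (_ * _).
(* [h i] is the probability that the second set agrees with [X] at [i]; it is the factor of an [i]
   outside the first set. *)
pose h i : R := P2 i * (i \in X)%:R + (1 - P2 i) * (i \notin X)%:R.
transitivity (expct P1 (fun A => \prod_i (if i \in A then (i \in X)%:R else h i))).
  rewrite expct_prod; apply: eq_bigr => i _; rewrite /h.
  have := PE i; case: (i \in X) => /= e; last by rewrite e; ring.
  have -> : P i = 1 - (1 - P1 i) * (1 - P2 i) by rewrite -e; ring.
  by ring.
apply: eq_expct => A.
transitivity (expct P2 (fun B => \prod_i (if i \in B then (i \in X)%:R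
    else if i \in A then (i \in X)%:R else (i \notin X)%:R))).
  rewrite expct_prod; apply: eq_bigr => i _; rewrite /h; case: ifP => _ //; ring.
apply: eq_expct => B; rewrite -[A :|: B]setIT eq_setI_prod; apply: eq_bigr => i _.
by rewrite !inE; case: (i \in A); case: (i \in B); case: (i \in X).
Qed.

(** * Graph search *)

Section Exploration.
Variables (T : finType).
Implicit Types (S : {set {set T}}) (u v x y : T) (Q W D : {set T}).

Definition adj S : rel T := fun x y => [set x; y] \in S.

Definition component S u : {set T} := [set v | connect (adj S) u v].

Definition nbrs S u W : {set T} := [set x in W | adj S u x].

(** The pairs that the search reveals when it processes [u]. *)
Definition star u W : {set {set T}} := [set [set u; x] | x in W].

Lemma adj_sym S : symmetric (adj S).
Proof. by move=> x y; rewrite /adj setUC. Qed.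

Lemma connect_adj_sym S : connect_sym (adj S).
Proof. exact/sym_connect_sym/adj_sym. Qed.

Lemma set2_injr u : injective (fun x => [set u; x]).
Proof.
move=> x y /setP e; have := e x; have := e y; rewrite !inE !eqxx !orbT.
by case/orP => [/eqP->|/eqP->] //; case/esym/orP => /eqP->.
Qed.

Lemma nbrs_sub S u W : nbrs S u W \subset W.
Proof. by apply/subsetP => x; rewrite inE => /andP[]. Qed.

Lemma nbrs_setI S u W : nbrs (S :&: star u W) u W = nbrs S u W.
Proof.
apply/setP => x; rewrite !inE /adj inE; case xW: (x \in W) => //=.
by rewrite (imset_f (fun x => [set u; x]) xW) andbT.
Qed.

Lemma card_nbrs S u W : #|nbrs S u W| = #|S :&: star u W|.
Proof.
rewrite -(card_imset _ (@set2_injr u)); apply: eq_card => e.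
apply/imsetP/idP => [[x]|]; rewrite !inE.
  by case/andP=> xW; rewrite /adj => ux ->; rewrite ux; apply/imsetP; exists x.
by case/andP=> eS /imsetP[x xW ex]; exists x; rewrite // inE xW /adj -ex.
Qed.

Lemma card_star u W : #|star u W| = #|W|.
Proof. by rewrite card_imset //; apply: set2_injr. Qed.

Variables (R : realFieldType) (stop : nat -> nat -> bool) (g : nat -> nat -> R) (c : R).

(* Graph search: [Q] holds the discovered but unprocessed vertices and [W] the
   undiscovered ones.  The search restarts from [W] when [Q] is empty, and collects
   [c] for each processed vertex and [g] on stopping; [k] is fuel. *)
Fixpoint explore k S Q W : R :=
  if stop #|Q| #|W| then g #|Q| #|W| else
  if k is k'.+1 then
    if [pick u in Q] is Some u then
      c + explore k' S (Q :\ u :|: nbrs S u W) (W :\: nbrs S u W)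
    else if [pick u in W] is Some u then explore k' S [set u] (W :\ u)
    else 0
  else 0.

(** Every pair queried from the state [(Q, W)] on has one end in [W] and the other in [Q :|: W]. *)
Lemma eq_explore k S S' Q W :
  (forall x y, x \in Q :|: W -> y \in W -> adj S x y = adj S' x y) ->
  explore k S Q W = explore k S' Q W.
Proof.
elim: k Q W => [|k IH] Q W eSS //=; case: ifP => // _.
case: pickP => [u uQ|_].
  have -> : nbrs S u W = nbrs S' u W.
    apply/setP => x; rewrite !inE; case xW: (x \in W) => //=.
    by apply: eSS; rewrite // inE uQ.
  congr (_ + _); apply: IH => x y; rewrite !inE => xQW /andP[_ yW].
  by apply: eSS => //; rewrite inE; case/orP: xQW => [/orP[]|] /andP[] => [_ ->|->|_ ->];
    rewrite ?orbT.
case: pickP => [u uW|//]; apply: IH => x y; rewrite !inE => xuW /andP[_ yW].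
by apply: eSS => //; rewrite inE; case/orP: xuW => [/eqP->|/andP[_ ->]]; rewrite ?uW orbT.
Qed.

(** Once [u] has left both sets its pairs are never queried again; the rest of the search is thus
    independent of what was revealed at [u]. *)
Lemma explore_setD k S u W0 Q W : u \notin Q :|: W ->
  explore k (S :\: star u W0) Q W = explore k S Q W.
Proof.
move=> uQW; apply: eq_explore => x y xQW yW; rewrite /adj inE.
case: imsetP => // -[z _ /setP/(_ u)]; rewrite !inE eqxx /=.
by move/orP=> [] /eqP e; move: uQW; rewrite e ?xQW // inE yW orbT.
Qed.

Variables (P : {set T} -> R) (Phi : nat -> nat -> R).
Hypothesis P01 : forall e, 0 <= P e <= 1.
Hypothesis Phi_ge0 : forall q w, 0 <= Phi q w.
Hypothesis Phi_stop : forall q w, stop q w -> g q w <= Phi q w.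
Hypothesis Phi_step : forall u W q, u \notin W -> ~~ stop q.+1 #|W| ->
  c + expct P (fun S => Phi (q + #|nbrs S u W|)%N (#|W| - #|nbrs S u W|)%N) <= Phi q.+1 #|W|.
Hypothesis Phi_restart : forall w, ~~ stop 0 w.+1 -> Phi 1 w <= Phi 0 w.+1.

(* [Phi] is a supermartingale along the search: the pairs from a processed vertex
   to [W] have not been revealed before and are never looked at again. *)
Lemma expct_explore k Q W : [disjoint Q & W] ->
  expct P (fun S => explore k S Q W) <= Phi #|Q| #|W|.
Proof.
elim: k Q W => [|k IH] Q W dQW /=.
  by rewrite expct_cst; case: ifP => [/Phi_stop|].
have [/Phi_stop|nstop] := boolP (stop #|Q| #|W|); first by rewrite expct_cst.
case: pickP => [u uQ|Q0]; last first.
  case: pickP => [u uW|_]; last by rewrite expct_cst.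
  have Q0' : #|Q| = 0%N by apply: eq_card0 => x; apply: Q0.
  move: nstop; rewrite Q0' (cardsD1 u W) uW add1n => /Phi_restart; apply: le_trans.
  by rewrite -(cards1 u); apply: IH; rewrite disjoints1 !inE eqxx.
have uW : u \notin W by rewrite (disjointFr dQW uQ).
(* [X] carries the pairs revealed at [u], which fix the next state, and [Y] the pairs that the
   remaining search queries. Conditioning on [X] then reduces the claim to the induction
   hypothesis. *)
pose f X Y := explore k Y (Q :\ u :|: nbrs X u W) (W :\: nbrs X u W).
have fE S : explore k S (Q :\ u :|: nbrs S u W) (W :\: nbrs S u W) =
    f (S :&: star u W) (S :\: star u W).
  rewrite /f nbrs_setI explore_setD // !inE eqxx /=.
  by rewrite (negPf uW) andbF orbF.
rewrite expctD expct_cst; under eq_expct => S do rewrite fE.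
move: nstop; rewrite (cardsD1 u Q) uQ add1n => /(Phi_step uW); apply: le_trans.
rewrite lerD2l.
under [leRHS]eq_expct => S do rewrite -nbrs_setI.
pose phi X := Phi (#|Q :\ u| + #|nbrs X u W|)%N (#|W| - #|nbrs X u W|)%N.
apply: (@expct_split_le _ _ P P01 (star u W) f phi).
move=> X _; rewrite /f /phi.
have -> : expct P (fun B => explore k (B :\: star u W) (Q :\ u :|: nbrs X u W) (W :\: nbrs X u W))
  = expct P (fun B => explore k B (Q :\ u :|: nbrs X u W) (W :\: nbrs X u W)).
  apply: eq_expct => B; rewrite explore_setD // !inE eqxx /=.
  by rewrite (negPf uW) andbF orbF.
have sN := nbrs_sub X u W.
have dN : [disjoint Q :\ u & nbrs X u W].
  apply: disjointWl (disjointWr sN dQW); exact: subD1set.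
have -> : (#|Q :\ u| + #|nbrs X u W|)%N = #|Q :\ u :|: nbrs X u W|.
  by rewrite cardsU disjoint_setI0 // cards0 subn0.
rewrite -(cardsDS sN); apply: IH.
rewrite disjoints_subset; apply/subsetP => x; rewrite !inE negb_and negbK.
case/orP=> [/andP[_ xQ]|/andP[-> ->]] //.
by rewrite (disjointFr dQW xQ) orbT.
Qed.

End Exploration.

(** * Subcritical component sizes, and the probability that all components are small *)

Section SearchOutcome.
Variables (T : finType) (R : realFieldType).
Implicit Types (S : {set {set T}}) (u v x y r : T) (Q W D : {set T}) (p : R).

(** With these probabilities the random subset is almost surely a set of pairs, namely the edge set
    of a binomial random graph. *)
Definition edge_prob p (e : {set T}) : R := if #|e| == 2%N then p else 0.

Lemma edge_prob01 p : 0 <= p <= 1 -> forall e, 0 <= edge_prob p e <= 1.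
Proof. by move=> p01 e; rewrite /edge_prob; case: ifP; rewrite ?lexx ?ler01. Qed.

Lemma edge_prob_star p u W e : u \notin W -> e \in star u W -> edge_prob p e = p.
Proof.
move=> uW /imsetP[x xW ->]; rewrite /edge_prob cards2.
by have [ux|//] := eqVneq u x; rewrite ux xW in uW.
Qed.

Lemma sum_star p u W : u \notin W -> \sum_(e in star u W) edge_prob p e = p * #|W|%:R.
Proof.
move=> uW; rewrite (eq_bigr (fun=> p)) => [|e eS]; last exact: edge_prob_star eS.
by rewrite sumr_const card_star mulr_natr.
Qed.

Lemma expct_card_nbrs p u W : u \notin W ->
  expct (edge_prob p) (fun S => #|nbrs S u W|%:R) = p * #|W|%:R.
Proof.
by move=> uW; under eq_expct => S do rewrite card_nbrs; rewrite expct_cardI sum_star.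
Qed.

Lemma expct_exp_nbrs p u W z : u \notin W ->
  expct (edge_prob p) (fun S => z ^+ #|nbrs S u W|) = (1 - p + p * z) ^+ #|W|.
Proof.
move=> uW; under eq_expct => S do rewrite card_nbrs; rewrite expct_expcard.
rewrite (eq_bigr (fun=> 1 - p + p * z)) => [|e eS]; last by rewrite (edge_prob_star _ uW eS).
by rewrite prodr_const card_star.
Qed.

(** The search without restarts: it stops when the queue is empty and returns the number of vertices
    processed. *)
Definition count_explore : nat -> _ -> _ -> _ -> R :=
  @explore T R (fun q _ => q == 0%N) (fun _ _ => 0) 1.

(** [D] holds the processed vertices. When the queue empties, no edge leaves [D], so the component
    of [r] is inside [D]. Each step lowers [#|Q| + #|W|] by one, so the fuel suffices. *)
Lemma card_comp_explore k S Q W D r : (#|Q| + #|W| <= k)%N ->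
  (forall x, x \in Q :|: W :|: D) ->
  (forall x y, x \in D -> y \in W -> ~~ adj S x y) -> r \in D :|: Q ->
  #|component S r|%:R <= #|D|%:R + count_explore k S Q W.
Proof.
have base Q' W' D' : Q' = set0 -> (forall x, x \in Q' :|: W' :|: D') ->
  (forall x y, x \in D' -> y \in W' -> ~~ adj S x y) -> r \in D' :|: Q' ->
  #|component S r|%:R <= #|D'|%:R + 0 :> R.
  move=> -> cov DW; rewrite setU0 => rD; rewrite addr0 ler_nat; apply: subset_leq_card.
  apply/subsetP => v; rewrite inE => rv.
  have cD : closed (adj S) D'.
    apply: intro_closed; first exact: connect_adj_sym.
    move=> x y xy xD; have := cov y; rewrite !inE /= => /orP[yW|//].
    by have := DW x y xD yW; rewrite xy.
  by rewrite -(closed_connect cD rv).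
rewrite /count_explore.
elim: k Q W D => [|k IH] Q W D /= kQW cov DW rDQ.
  have Q0 : Q = set0 by apply/eqP; rewrite -cards_eq0; lia.
  by rewrite Q0 cards0 eqxx; apply: base cov DW rDQ.
case: ifP => [|Qn0]; first by rewrite cards_eq0 => /eqP Q0; apply: base cov DW rDQ.
case: pickP => [u uQ|Q0]; last by rewrite eq_card0 in Qn0.
set N := nbrs S u W.
have := IH (Q :\ u :|: N) (W :\: N) (u |: D); rewrite addrA => h.
apply: le_trans (h _ _ _ _) _.
- have := cardsU (Q :\ u) N; have := cardsDS (nbrs_sub S u W); rewrite -/N.
  have := subset_leq_card (nbrs_sub S u W); rewrite -/N.
  have := cardsD1 u Q; rewrite uQ; lia.
- move=> x; have := cov x; rewrite !inE; case: (x == u); rewrite ?orbT //=.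
  by case: (x \in Q) => //=; case: (x \in W) => //=; case: (adj S u x).
- move=> x y; rewrite 2!inE => /orP[/eqP->|xD] /setDP[yW nN]; last exact: DW.
  by apply: contra nN => uy; rewrite inE yW.
- by move: rDQ; rewrite !inE; case: (r == u) => //=; case: (r \in D) => //= ->.
rewrite lerD2r cardsU1 natrD [leRHS]addrC lerD2r.
by case: (u \in D).
Qed.

(** Comparison with a subcritical branching process: a processed vertex discovers at most [nu] new
    ones on average, so each queued vertex accounts for at most [1 / (1 - nu)] processed ones. The
    potential is linear in the queue length. *)
Lemma expct_count p nu k Q W : 0 <= p <= 1 -> p * #|T|%:R <= nu -> nu < 1 ->
  [disjoint Q & W] ->
  expct (edge_prob p) (fun S => count_explore k S Q W) <= #|Q|%:R / (1 - nu).
Proof.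
move=> p01 pnu nu1 dQW; have n1 : 0 < 1 - nu by rewrite subr_gt0.
apply: (@expct_explore _ _ _ _ _ _ (fun q _ => q%:R / (1 - nu))) => //.
- exact: edge_prob01.
- by move=> q w; rewrite divr_ge0 // ltW.
- by move=> q w _; rewrite divr_ge0 // ltW.
- move=> u V q uV _.
  under eq_expct => S do rewrite natrD mulrDl mulrC [_ / _ in X in _ + X]mulrC.
  rewrite expctD !expctZ expct_cst expct_card_nbrs // !(mulrC (1 - nu)^-1).
  rewrite -natr1 mulrDl addrC -addrA lerD2l.
  rewrite -[X in _ + X](divff (lt0r_neq0 n1)) -mulrDl ler_pM2r ?invr_gt0 //.
  have : p * #|V|%:R <= p * #|T|%:R.
    by case/andP: p01 => p0 _; rewrite ler_wpM2l // ler_nat max_card.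
  lra.
Qed.

Lemma expct_card_comp p nu u : 0 <= p <= 1 -> p * #|T|%:R <= nu -> nu < 1 ->
  expct (edge_prob p) (fun S => #|component S u|%:R) <= (1 - nu)^-1.
Proof.
move=> p01 pnu nu1; set k := (#|[set u]| + #|~: [set u]|)%N.
apply: le_trans (_ : _ <= expct _ (fun S => count_explore k S [set u] (~: [set u]))) _.
  apply: le_expct => [|S _]; first exact: edge_prob01.
  have := @card_comp_explore k S [set u] (~: [set u]) set0 u.
  rewrite cards0 add0r; apply => //.
  - by move=> x; rewrite !inE orbN.
  - by move=> x y; rewrite inE.
  - by rewrite !inE eqxx orbT.
apply: le_trans (expct_count _ p01 pnu nu1 _) _; last by rewrite cards1 mul1r.
by rewrite disjoints1 !inE eqxx.
Qed.

(** Bounds a cubic moment of a degree by its generating function at 2, which is explicit. *)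
Lemma sqr_succ_le_exp2 k : (k ^ 2 * k.+1 <= 6 * (2 ^ k - 1))%N.
Proof.
elim: k => [//|k IH]; case: k IH => [//|[//|[//|[//|k]]]] IH.
(* From 4 on, the left-hand side at most doubles from one integer to the next; the smaller cases
   were settled by computation. *)
rewrite (expnS 2); move: IH; rewrite -!mulnn; move: (2 ^ k.+4)%N => z IH.
have : (k.+4.+1 * k.+4.+1 * k.+4.+2 <= 2 * (k.+4 * k.+4 * k.+4.+1))%N by nia.
lia.
Qed.

(** Bernoulli's inequality for [(1 - p) ^+ n], combined with [(1 - p) * (1 + p) <= 1]. *)
Lemma exp1D_le p n : 0 <= p <= 1 -> p * n%:R < 1 -> (1 + p) ^+ n <= (1 - p * n%:R)^-1.
Proof.
move=> /andP[p0 p1] pn.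
have q0 : 0 <= 1 - p by rewrite subr_ge0.
have B : 1 - p * n%:R <= (1 - p) ^+ n.
  elim: n {pn} => [|n IH]; first by rewrite mulr0 subr0 expr0.
  rewrite exprS; apply: le_trans (ler_wpM2l q0 IH).
  have : 0 <= p ^+ 2 * n%:R by rewrite mulr_ge0 ?sqr_ge0.
  by rewrite -natr1; lra.
rewrite -[leRHS]mul1r ler_pdivlMr ?subr_gt0 //.
apply: le_trans (ler_wpM2l _ B) _; first by rewrite exprn_ge0 // addr_ge0.
rewrite -exprMn exprn_ile1 //; first by rewrite mulr_ge0 // addr_ge0.
by have := sqr_ge0 p; lra.
Qed.

(** Reveal the pairs at [u] first. Given its degree [d], the component has mean size at most
    [1 + d / (1 - nu)], hence at most [(d + 1) / (1 - nu)]; then [d ^+ 2 * (d + 1)] is bounded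
    through [2 ^+ d], whose mean is at most [1 / (1 - nu)]. *)
Lemma expct_sqr_nbrs_comp p nu u : 0 <= p <= 1 -> p * #|T|%:R <= nu -> nu < 1 ->
  expct (edge_prob p) (fun S => #|nbrs S u (~: [set u])|%:R ^+ 2 * #|component S u|%:R)
    <= 6 * nu / (1 - nu) ^+ 2.
Proof.
move=> p01 pnu nu1; set V := ~: [set u].
have n1 : 0 < 1 - nu by rewrite subr_gt0.
have nu0 : 0 <= nu by apply: le_trans pnu; case/andP: p01 => p0 _; rewrite mulr_ge0.
have uV : u \notin V by rewrite !inE eqxx.
have uN X : u \notin nbrs X u V :|: V :\: nbrs X u V.
  by apply: contra uV; rewrite in_setU => /orP[/(subsetP (nbrs_sub _ _ _))|/setDP[]].
pose f X Y : R := #|nbrs X u V|%:R ^+ 2 *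
  (1 + count_explore #|V| Y (nbrs X u V) (V :\: nbrs X u V)).
have fE S : #|nbrs S u V|%:R ^+ 2 * #|component S u|%:R <= f (S :&: star u V) (S :\: star u V).
  rewrite /f nbrs_setI ler_wpM2l ?sqr_ge0 //.
  rewrite /count_explore explore_setD //.
  have := @card_comp_explore #|V| S (nbrs S u V) (V :\: nbrs S u V) [set u] u.
  rewrite cards1; apply.
  - by rewrite cardsDS ?nbrs_sub // subnKC // subset_leq_card // nbrs_sub.
  - move=> x; rewrite setDE setUIr setUCr setIT !in_setU in_set1 /V in_setC in_set1.
    by case: (x == u); rewrite ?orbT.
  - move=> x y; rewrite inE => /eqP-> /setDP[yV nN].
    by apply: contra nN => uy; rewrite inE yV.
  - by rewrite !inE eqxx.
apply: le_trans (le_expct (edge_prob01 p01) (fun S _ => fE S)) _.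
pose phi X : R := 6 / (1 - nu) * (2 ^+ #|nbrs X u V| - 1).
apply: le_trans (@expct_split_le _ _ _ (edge_prob01 p01) (star u V) f phi _) _.
  move=> X _; rewrite /f; set N := nbrs X u V; set d := #|N|%:R : R.
  have -> : expct (edge_prob p) (fun B =>
     d ^+ 2 * (1 + count_explore #|V| (B :\: star u V) N (V :\: N))) =
     d ^+ 2 * (1 + expct (edge_prob p) (fun B => count_explore #|V| B N (V :\: N))).
    rewrite expctZ expctD expct_cst; congr (_ * (_ + _)); apply: eq_expct => B.
    by rewrite /count_explore explore_setD //; apply: uN.
  have dN : [disjoint N & V :\: N].
    by rewrite disjoints_subset setDE setCI setCK subsetUr.
  apply: (@le_trans _ _ (d ^+ 2 * (1 + d / (1 - nu)))).
    by rewrite ler_wpM2l ?sqr_ge0 // lerD2l; apply: expct_count p01 pnu nu1 dN.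
  have -> : phi X = (6 * (2 ^+ #|N| - 1)) / (1 - nu) by rewrite /phi mulrAC.
  have h : d ^+ 2 * (d + 1) <= 6 * (2 ^+ #|N| - 1).
    have := sqr_succ_le_exp2 #|N|; rewrite -(ler_nat R) !natrM -natr1.
    by rewrite natrB ?expn_gt0 // !natrX.
  rewrite ler_pdivlMr //; apply: le_trans h.
  have -> : d ^+ 2 * (1 + d / (1 - nu)) * (1 - nu) = d ^+ 2 * (1 - nu + d).
    by field; rewrite gt_eqF.
  by rewrite ler_wpM2l ?sqr_ge0 //; lra.
rewrite /phi; under eq_expct => S do rewrite nbrs_setI.
rewrite expctZ; under eq_expct => S do rewrite addrC.
rewrite expctD expct_cst expct_exp_nbrs //.
have pV : p * #|V|%:R <= nu.
  by apply: le_trans pnu; case/andP: p01 => p0 _; rewrite ler_wpM2l // ler_nat max_card.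
have -> : 6 * nu / (1 - nu) ^+ 2 = 6 / (1 - nu) * (nu / (1 - nu)).
  by field; rewrite gt_eqF.
rewrite ler_wpM2l ?divr_ge0 ?(ltW n1) //.
have -> : 1 - p + p * 2 = 1 + p by ring.
have -> : nu / (1 - nu) = (1 - nu)^-1 - 1 by field; rewrite gt_eqF.
rewrite addrC lerD2r; apply: le_trans (exp1D_le p01 (le_lt_trans pV nu1)) _.
by rewrite lef_pV2 ?posrE; lra.
Qed.

(** The queue always lies in a single component, so if all components are small it has at most [L]
    vertices when the undiscovered set shrinks to [w0]. The potential [K * (a ^+ q * b ^+ w)] is at
    least 1 at such a stop, does not increase on average, and starts at [K * b ^+ #|T|]. *)
Lemma prob_small_comps p (a b K L : R) w0 : 0 <= p <= 1 -> 0 <= a <= b -> 0 < b -> 0 <= K ->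
  0 <= L ->
  (forall q w : nat, q%:R <= L -> (w <= w0)%N -> 1 <= K * (a ^+ q * b ^+ w)) ->
  (forall w, (w0 < w <= #|T|)%N -> (1 - p + p * (a / b)) ^+ w <= a) ->
  prob (edge_prob p) (fun S => [forall r, #|component S r|%:R <= L]) <= K * b ^+ #|T|.
Proof.
move=> p01 /andP[a0 ab] b0 K0 L0 stopK stepK.
pose small := @explore T R (fun _ w => w <= w0)%N (fun q _ => (q%:R <= L :> R)%R%:R) 0.
have Phi0 q w : 0 <= K * (a ^+ q * b ^+ w).
  by rewrite mulr_ge0 // mulr_ge0 // exprn_ge0 // ltW.
(* The quantity [2 * #|W| + #|Q|] decreases at every step, restarts included, so the fuel lasts
   until the stop. *)
have smallE S k Q W : (2 * #|W| + #|Q| <= k)%N -> (forall r, #|component S r|%:R <= L) ->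
    Q = set0 \/ (exists r, Q \subset component S r) -> small k S Q W = 1.
  move=> kW cL; have QL Q' : Q' = set0 \/ (exists r, Q' \subset component S r) -> #|Q'|%:R <= L.
    move=> [->|[r Qr]]; first by rewrite cards0.
    by apply: le_trans (cL r); rewrite ler_nat subset_leq_card.
  rewrite /small; elim: k Q W kW => [|k IH] Q W kW Qr /=.
    by rewrite ifT ?QL //; lia.
  case: ifP => [_|/negbT]; first by rewrite QL.
  rewrite -ltnNge => w0W; case: pickP => [u uQ|Q0].
    rewrite add0r; apply: IH.
      have := cardsU (Q :\ u) (nbrs S u W); have := cardsDS (nbrs_sub S u W).
      have := subset_leq_card (nbrs_sub S u W).
      have := cardsD1 u Q; rewrite uQ; lia.
    right; case: Qr => [Q0|[r Qr]]; first by rewrite Q0 inE in uQ.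
    exists r; rewrite subUset (subset_trans (subD1set _ _) Qr) /=.
    apply/subsetP => x; rewrite !inE => /andP[_ ux].
    by have := subsetP Qr u uQ; rewrite inE => /connect_trans; apply; apply: connect1.
  case: pickP => [u uW|W0]; last by rewrite (eq_card0 W0) in w0W.
  apply: IH; first by have := cardsD1 u W; rewrite uW cards1; lia.
  by right; exists u; rewrite sub1set inE connect0.
have dT : [disjoint (set0 : {set T}) & [set: T]] by rewrite -setI_eq0 set0I.
have h := @expct_explore T R (fun _ w => w <= w0)%N (fun q _ => (q%:R <= L :> R)%R%:R) 0
  (edge_prob p) (fun q w => K * (a ^+ q * b ^+ w)) (edge_prob01 p01) Phi0 _ _ _
  (2 * #|T|) set0 [set: T] dT.
apply: le_trans (_ : _ <= expct (edge_prob p) (fun S => small (2 * #|T|)%N S set0 [set: T])) _.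
  apply: le_expct => [|S _]; first exact: edge_prob01.
  case: forallP => [cL|_]; last first.
    rewrite /small; elim: (2 * _)%N {h dT} set0 [set: T] => [|k IH] Q W /=; case: ifP => _ //.
    by case: pickP => [u _|_]; [rewrite add0r; apply: IH | case: pickP].
  by rewrite smallE ?lexx //; [rewrite cardsT cards0 addn0 | left].
apply: le_trans (h _ _ _) _.
- by move=> q w ww0; case: (leP q%:R L) => qL /=; rewrite ?Phi0 // stopK.
- move=> u W q uW; rewrite -ltnNge => w0W; rewrite add0r.
  have -> : expct (edge_prob p) (fun S => K * (a ^+ (q + #|nbrs S u W|) * b ^+ (#|W| - #|nbrs S u W|)))
    = K * (a ^+ q * b ^+ #|W|) * (1 - p + p * (a / b)) ^+ #|W|.
    rewrite -(expct_exp_nbrs _ _ uW) -expctZ; apply: eq_expct => S.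
    have NW := subset_leq_card (nbrs_sub S u W).
    rewrite exprD -[in RHS](subnK NW) exprD expr_div_n.
    have := expf_neq0 #|nbrs S u W| (lt0r_neq0 b0).
    move: (b ^+ #|nbrs S u W|) (b ^+ _) (a ^+ q) (a ^+ _) => z1 z2 z3 z4 nz.
    by field.
  apply: le_trans (ler_wpM2l (Phi0 _ _) (stepK #|W| _)) _.
    by rewrite w0W max_card.
  by rewrite exprS le_eqVlt; apply/orP; left; apply/eqP; ring.
- move=> w _; rewrite expr1 expr0 mul1r exprS ler_wpM2l // ler_wpM2r //.
  by rewrite exprn_ge0 // ltW.
by rewrite cards0 cardsT expr0 mul1r.
Qed.

End SearchOutcome.

(** * Modularity of a fixed graph *)

Section ModularityBounds.
Variables (T : finType) (R : realType).
Implicit Types (G : sgraph T) (S F : {set {set T}}) (P : {set {set T}}) (A U : {set T}).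

Lemma card_edge G e : e \in edges G -> #|e| = 2%N.
Proof. by case: G => E /= /forall_inP h /h /eqP. Qed.

Lemma edge_set2 G e : e \in edges G -> exists x y, x != y /\ e = [set x; y].
Proof.
by move=> /card_edge/eqP/cards2P[x [y [xy ->]]]; exists x, y.
Qed.

Lemma degree_nbrs G u : degree G u = #|nbrs (edges G) u (~: [set u])|.
Proof.
rewrite card_nbrs; apply: eq_card => e; rewrite !inE; case eG: (e \in edges G) => //=.
have [x [y [xy ee]]] := edge_set2 eG; rewrite ee !inE.
apply/idP/imsetP => [/orP[]/eqP->|[z _ /setP/(_ u)]].
- by exists y; rewrite ?inE // eq_sym.
- by exists x; rewrite ?inE // setUC.
by rewrite !inE eqxx.
Qed.

Definition inner P (e : {set T}) : bool := [exists A in P, e \subset A].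

Lemma sum_subset_block P (e : {set T}) : trivIset P -> (0 < #|e|)%N ->
  (\sum_(A in P) (e \subset A) = inner P e)%N.
Proof.
move=> tP /card_gt0P[x xe]; rewrite /inner; case: exists_inP => [[A AP eA]|nA].
  rewrite (bigD1 A) //= eA big1 ?addn0 // => B /andP[BP BA].
  case: (boolP (e \subset B)) => // eB; case/negP: BA; apply/eqP.
  have := subsetP eA x xe; have := subsetP eB x xe.
  by move=> /(def_pblock tP BP) <- /(def_pblock tP AP) <-.
rewrite big1 // => A AP; case: (boolP (e \subset A)) => // eA.
by case: nA; exists A.
Qed.

Lemma card_edges_sum G (Q : pred {set T}) :
  (#|[set e in edges G | Q e]| = \sum_(e in edges G) Q e)%N.
Proof.
rewrite -sum1_card big_mkcond [RHS]big_mkcond; apply: eq_bigr => e _.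
by rewrite inE; case: (e \in edges G); case: (Q e).
Qed.

Lemma sum_edges_within G P : trivIset P ->
  (\sum_(A in P) edges_within G A = #|[set e in edges G | inner P e]|)%N.
Proof.
move=> tP; rewrite /edges_within.
rewrite card_edges_sum; under eq_bigr => A _ do rewrite card_edges_sum.
rewrite exchange_big /=; apply: eq_bigr => e eG.
by rewrite sum_subset_block // (card_edge eG).
Qed.

Lemma sum_degree G A : (vol G A = \sum_(e in edges G) #|e :&: A|)%N.
Proof.
rewrite /vol (eq_bigr (fun v => \sum_(e in edges G) (v \in e)))%N; last first.
  move=> v _; rewrite /degree -sum1_card big_mkcond [RHS]big_mkcond.
  by apply: eq_bigr => e _; rewrite inE; case: (e \in _); case: (v \in e).
rewrite exchange_big /=; apply: eq_bigr => e _.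
rewrite -sum1_card big_mkcond [RHS]big_mkcond.
by apply: eq_bigr => v _; rewrite inE; case: (v \in e); case: (v \in A).
Qed.

Lemma vol_setT G : (vol G [set: T] = 2 * n_edges G)%N.
Proof.
rewrite sum_degree (eq_bigr (fun=> 2%N)) => [|e eG]; last by rewrite setIT (card_edge eG).
by rewrite sum_nat_const mulnC.
Qed.

(** Edge by edge: the number of ends in [U], plus 1 if there are none, equals 1, plus 1 if both ends
    are in [U]. Volumes are thereby controlled by edge counts inside [U] and its complement. *)
Lemma vol_setC G U :
  (vol G U + edges_within G (~: U) = n_edges G + edges_within G U)%N.
Proof.
rewrite sum_degree /edges_within !card_edges_sum /n_edges -sum1_card -!big_split /=.
apply: eq_bigr => e /edge_set2[x [y [xy ->]]].
rewrite !subUset !sub1set !inE setIUl cardsU.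
have I1 z : #|[set z] :&: U| = (z \in U) :> nat.
  case: (boolP (z \in U)) => zU; first by rewrite (setIidPl _) ?sub1set ?cards1.
  by rewrite disjoint_setI0 ?disjoints1 ?cards0.
have -> : [set x] :&: U :&: ([set y] :&: U) = set0.
  apply/setP => z; rewrite !inE; case: eqVneq => //= ->.
  by rewrite (negPf xy) andbF.
by rewrite !I1 cards0 subn0; case: (x \in U); case: (y \in U).
Qed.

Lemma score_le_modularity G P : n_edges G != 0%N -> finset.partition P [set: T] ->
  modularity_score R G P <= modularity R G.
Proof. by move=> m0 PT; rewrite /modularity (negPf m0); apply: le_bigmax_cond. Qed.

Lemma partition_setT : (0 < #|T|)%N -> finset.partition [set [set: T]] [set: T].
Proof.
move=> T0; apply/and3P; split.
- by rewrite /cover big_set1.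
- by apply/trivIsetP => A B; rewrite !inE => /eqP-> /eqP->; rewrite eqxx.
- by rewrite inE eq_sym -cards_eq0 cardsT -lt0n.
Qed.

(** The one-block partition has score 0, since its volume is twice the number of edges. *)
Lemma modularity_ge0 G : (0 < #|T|)%N -> 0 <= modularity R G.
Proof.
move=> T0; have [m0|m0] := eqVneq (n_edges G) 0%N; first by rewrite /modularity m0 eqxx.
apply: le_trans (score_le_modularity m0 (partition_setT T0)).
rewrite /modularity_score !big_set1 vol_setT.
have -> : edges_within G [set: T] = n_edges G.
  by apply: eq_card => e; rewrite inE subsetT andbT.
rewrite natrM; have m0' : (n_edges G)%:R != 0 :> R by rewrite pnatr_eq0.
by rewrite le_eqVlt; apply/orP; left; apply/eqP; field.
Qed.

Lemma modularity_le G x : (0 < #|T|)%N -> 0 <= x ->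
  (forall P, n_edges G != 0%N -> finset.partition P [set: T] -> modularity_score R G P <= x) ->
  modularity R G <= x.
Proof.
move=> T0 x0 h; rewrite /modularity; case: eqVneq => [//|m0].
by apply/bigmax_leP; split=> [|P PT]; apply: h => //; apply: partition_setT.
Qed.

Lemma sum_inner_le G P : finset.partition P [set: T] ->
  \sum_(A in P) (edges_within G A)%:R <= (n_edges G)%:R :> R.
Proof.
move=> /and3P[_ tP _]; rewrite -natr_sum sum_edges_within // ler_nat.
by apply: subset_leq_card; apply/subsetP => e; rewrite inE => /andP[].
Qed.

Lemma modularity_le1 G : (0 < #|T|)%N -> modularity R G <= 1.
Proof.
move=> T0; apply: modularity_le => // P m0 PT; rewrite /modularity_score.
have m0' : 0 < (n_edges G)%:R :> R by rewrite ltr0n lt0n.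
rewrite lerBlDr; apply: ler_wpDr.
  by rewrite mulr_ge0 ?invr_ge0 ?mulr_ge0 ?sqr_ge0 // sumr_ge0 // => A _; rewrite sqr_ge0.
by rewrite mulrC ler_pdivrMr // mul1r sum_inner_le.
Qed.

(** The Cauchy-Schwarz inequality, by summing [2 xy <= x^2 + y^2] over pairs of vertices. *)
Lemma sqr_vol_le G A : (vol G A ^ 2 <= \sum_(u in A) degree G u ^ 2 * #|A|)%N.
Proof.
rewrite -(leq_pmul2l (ltn0Sn 1)) -mulnn /vol big_distrl /=.
rewrite big_distrr /=.
apply: (@leq_trans (\sum_(u in A) \sum_(v in A) (degree G u ^ 2 + degree G v ^ 2))%N).
  apply: leq_sum => u _; rewrite !big_distrr /=; apply: leq_sum => v _.
  exact: nat_Cauchy.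
under eq_bigr => u _ do rewrite big_split sum_nat_const /=.
rewrite big_split /= sum_nat_const -big_distrl -big_distrr /=.
by rewrite mulnC leq_eqVlt; apply/orP; left; apply/eqP; lia.
Qed.

(** Score of the partition into components of [S]: every edge of [S] is inside a part, and the
    squared volumes are bounded by Cauchy-Schwarz on each part. *)
Lemma modularity_ge_comp G S : n_edges G != 0%N -> S \subset edges G ->
  #|S|%:R / (n_edges G)%:R - (4 * (n_edges G)%:R ^+ 2)^-1 *
    \sum_u #|nbrs (edges G) u (~: [set u])|%:R ^+ 2 * #|component S u|%:R <= modularity R G.
Proof.
move=> m0 SG; pose P := equivalence_partition (connect (adj S)) [set: T].
have eqR : {in [set: T] & &, equivalence_rel (connect (adj S))}.
  move=> x y z _ _ _; split=> [|xy]; first exact: connect0.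
  by apply/idP/idP; apply: connect_trans; rewrite // connect_adj_sym.
have PT := equivalence_partitionP eqR; rewrite -/P in PT.
have /and3P[/eqP cP tP _] := PT.
have pbE x y : (y \in pblock P x) = connect (adj S) x y.
  by rewrite pblock_equivalence_partition // in_setT.
have bE A u : A \in P -> u \in A -> A = component S u.
  by move=> AP uA; apply/setP => v; rewrite inE -pbE (def_pblock tP AP uA).
apply: le_trans (score_le_modularity m0 PT); rewrite /modularity_score.
have m0' : 0 < (n_edges G)%:R :> R by rewrite ltr0n lt0n.
rewrite lerB //.
  rewrite mulrC ler_wpM2l ?invr_ge0 ?(ltW m0') //.
  rewrite -natr_sum sum_edges_within // ler_nat; apply: subset_leq_card.
  apply/subsetP => e eS; have eG := subsetP SG e eS; rewrite inE eG /=.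
  have [x [y [xy ee]]] := edge_set2 eG; rewrite ee.
  apply/exists_inP; exists (pblock P x); first by rewrite pblock_mem // cP inE.
  by rewrite subUset !sub1set !pbE connect0 connect1 // /adj -ee.
rewrite ler_wpM2l ?invr_ge0 ?mulr_ge0 ?sqr_ge0 //.
have -> : \sum_u #|nbrs (edges G) u (~: [set u])|%:R ^+ 2 * #|component S u|%:R =
   (\sum_(u in [set: T]) degree G u ^ 2 * #|component S u|)%N%:R :> R.
  rewrite natr_sum; apply: eq_big => [u|u _]; first by rewrite in_setT.
  by rewrite natrM natrX degree_nbrs.
rewrite (set_partition_big _ PT) /= !natr_sum; apply: ler_sum => A AP.
rewrite -natrX ler_nat; apply: leq_trans (sqr_vol_le _ _) _.
by apply: leq_sum => u uA; rewrite -(bE A u).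
Qed.

(** Take for [F] the edges between parts. A score this high leaves few of them, and forces each
    volume to be at most [2 r m]. Components after the deletion stay inside parts, whose volume
    bounds their size. *)
Lemma modularity_score_ge G P r : n_edges G != 0%N -> finset.partition P [set: T] ->
  0 <= r -> 1 - r ^+ 2 <= modularity_score R G P ->
  exists F, [/\ F \subset edges G, #|F|%:R <= r ^+ 2 * (n_edges G)%:R &
    forall v, #|component (edges G :\: F) v|%:R <= 1 + 2 * r * (n_edges G)%:R].
Proof.
move=> m0 PT r0; have /and3P[/eqP cP tP _] := PT.
set m := (n_edges G)%:R : R; have m0' : 0 < m by rewrite ltr0n lt0n.
rewrite /modularity_score -/m; set X := \sum_(A in P) _; set Y := \sum_(A in P) _ => sc.
have Y0 : 0 <= Y by rewrite sumr_ge0 // => A _; rewrite sqr_ge0.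
have Xm : X <= m := sum_inner_le G PT.
have Xge : (1 - r ^+ 2) * m <= X.
  rewrite -ler_pdivlMr // mulrC; apply: le_trans sc _; rewrite gerBl.
  by rewrite mulr_ge0 ?invr_ge0 ?mulr_ge0 ?sqr_ge0.
have Yle : Y <= (2 * r * m) ^+ 2.
  have m4 : 0 < 4 * m ^+ 2 by rewrite mulr_gt0 // exprn_gt0.
  have -> : (2 * r * m) ^+ 2 = r ^+ 2 * (4 * m ^+ 2) by ring.
  rewrite -ler_pdivrMr // mulrC.
  have : m^-1 * X <= 1 by rewrite mulrC ler_pdivrMr // mul1r.
  lra.
have volle A : A \in P -> (vol G A)%:R <= 2 * r * m.
  move=> AP; rewrite -(@ler_pXn2r _ 2%N) ?nnegrE ?mulr_ge0 ?(ltW m0') //.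
  apply: le_trans Yle; rewrite /Y (bigD1 A) //= lerDl sumr_ge0 // => B _.
  by rewrite sqr_ge0.
exists [set e in edges G | ~~ inner P e]; split.
- by apply/subsetP => e; rewrite inE => /andP[].
- have : (#|[set e in edges G | inner P e]| + #|[set e in edges G | ~~ inner P e]| = n_edges G)%N.
    rewrite /n_edges -[RHS](cardsID [set e | inner P e]); congr (_ + _)%N; apply: eq_card => e.
      by rewrite !inE.
    by rewrite !inE andbC.
  move/(congr1 (fun k => k%:R : R)); rewrite natrD -sum_edges_within // natr_sum -/X -/m.
  lra.
move=> v; set S := _ :\: _.
have adjG x y : adj S x y -> adj (edges G) x y.
  by rewrite /adj inE => /andP[].
have adjP x y : adj S x y -> pblock P x = pblock P y.
  rewrite /adj !inE => /andP[]; case eG: (_ \in edges G) => //= /negPn /exists_inP[A AP].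
  rewrite subUset !sub1set => /andP[xA yA] _.
  by rewrite (def_pblock tP AP xA) (def_pblock tP AP yA).
have cP' x y : connect (adj S) x y -> pblock P x = pblock P y.
  case/connectP => p pa ->; elim: p x pa => [//|z p IH] x /= /andP[xz] /IH <-.
  exact: adjP.
have vA : v \in pblock P v by rewrite mem_pblock cP inE.
have AP : pblock P v \in P by rewrite pblock_mem // cP inE.
(* Every vertex of the component other than [v] has an edge, hence degree at least 1; the summand 1
   accounts for [v], which may be isolated. *)
have le1 : (#|component S v| <= 1 + vol G (pblock P v))%N.
  rewrite (cardsD1 v) inE connect0 leq_add2l /vol.
  apply: (@leq_trans (\sum_(x in component S v :\ v) degree G x)%N).
    rewrite -sum1_card; apply: leq_sum => x; rewrite !inE => /andP[xv].
    rewrite connect_adj_sym => /connectP[[|y p] /=]; first by move=> _ e; rewrite e eqxx in xv.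
    move=> /andP[/adjG xy _] _; apply/card_gt0P; exists [set x; y].
    by rewrite !inE eqxx andbT.
  rewrite [leqRHS](big_setID (component S v :\ v)) /= (setIidPr _) ?leq_addr //.
  by apply/subsetP => x; rewrite !inE => /andP[_ /cP' ->]; rewrite mem_pblock cP inE.
apply: le_trans (_ : _ <= (1 + vol G (pblock P v))%N%:R) _; first by rewrite ler_nat.
by rewrite natrD lerD2l volle.
Qed.

End ModularityBounds.

(** * Random unions of parts *)

Section UnionOfParts.
Variables (T : finType) (R : realType).
Implicit Types (G : sgraph T) (P : {set {set T}}) (U : {set T}).

Lemma expct_half_pair (I : finType) (i j : I) :
  expct (fun=> 2^-1 : R) (fun B => ([set i; j] \subset B)%:R) = 4^-1 + 4^-1 * (i == j)%:R.
Proof.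
rewrite -/(prob _ (fun B => [set i; j] \subset B)) prob_subset prodr_const cards2.
by case: eqP => _ /=; rewrite ?expr1 ?expr2; field.
Qed.

(* Choosing each part independently with probability 1/2, the union of the chosen
   parts has expected value [modularity_score R G P / 4]. *)
Lemma score_le_union G P (c : R) : n_edges G != 0%N -> finset.partition P [set: T] ->
  (forall U, (edges_within G U)%:R / (n_edges G)%:R
     - (vol G U)%:R ^+ 2 / (4 * (n_edges G)%:R ^+ 2) <= c) ->
  modularity_score R G P <= 4 * c.
Proof.
move=> m0 PT hc; have /and3P[/eqP cP tP _] := PT.
set m := (n_edges G)%:R : R; have m0' : 0 < m by rewrite ltr0n lt0n.
pose U (B : {set {set T}}) : {set T} := [set v | pblock P v \in B].
pose half : {set T} -> R := fun=> 2^-1.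
have half01 A : 0 <= half A <= 1 by rewrite /half; lra.
have same x y : (pblock P x == pblock P y) = inner P [set x; y].
  apply/eqP/exists_inP => [e|[A AP]].
    exists (pblock P x); first by rewrite pblock_mem // cP inE.
    by rewrite subUset !sub1set {2}e !mem_pblock cP !inE.
  rewrite subUset !sub1set => /andP[xA yA].
  by rewrite (def_pblock tP AP xA) (def_pblock tP AP yA).
set X := \sum_(A in P) (edges_within G A)%:R : R.
set Y := \sum_(A in P) (vol G A)%:R ^+ 2 : R.
(* An edge inside a part is kept with probability 1/2, an edge between two parts with probability
   1/4. *)
have EX : expct half (fun B => (edges_within G (U B))%:R) = 4^-1 * m + 4^-1 * X.
  under eq_expct => B do rewrite /edges_within card_edges_sum natr_sum.
  rewrite expct_sum.
  have -> : 4^-1 * m + 4^-1 * X = \sum_(e in edges G) (4^-1 + 4^-1 * (inner P e)%:R).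
    rewrite big_split -big_distrr /= sumr_const -[_ *+ #|_|]mulr_natr; congr (_ + _ * _).
    by rewrite /X -natr_sum sum_edges_within // card_edges_sum natr_sum.
  apply: eq_bigr => e /edge_set2[x [y [_ ->]]]; rewrite -same -expct_half_pair.
  by apply: eq_expct => B; rewrite !subUset !sub1set !inE.
(* The same computation for pairs of vertices weighted by degrees. The common 1/4 yields
   [(2 m)^2 / 4], which cancels the term [m / 4] of [EX] after normalization. *)
have EY : expct half (fun B => (vol G (U B))%:R ^+ 2) = m ^+ 2 + 4^-1 * Y.
  transitivity (expct half (fun B => \sum_u \sum_v ((degree G u)%:R * (degree G v)%:R) *
      ([set pblock P u; pblock P v] \subset B)%:R)).
    apply: eq_expct => B; rewrite /vol natr_sum expr2 big_distrl [LHS]big_mkcond.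
    apply: eq_bigr => u _; rewrite big_distrr [in LHS]big_mkcond /=.
    case: ifP => uB; last first.
      rewrite big1 // => v _; rewrite subUset !sub1set.
      by rewrite inE in uB; rewrite uB mulr0.
    apply: eq_bigr => v _; rewrite subUset !sub1set; rewrite inE in uB.
    by rewrite uB inE; case: (_ \in B); rewrite ?mulr1 ?mulr0.
  rewrite expct_sum; under eq_bigr => u _.
    rewrite expct_sum; under eq_bigr => v _ do rewrite expctZ expct_half_pair mulrDr.
    rewrite big_split /=. over.
  rewrite big_split /=; congr (_ + _).
    have dT : \sum_u (degree G u)%:R = 2 * m.
      rewrite /m -natrM -vol_setT /vol natr_sum.
      by apply: eq_bigl => v; rewrite inE.
    under eq_bigr => u _ do rewrite -big_distrl -big_distrr /= dT -mulrA.
    by rewrite -big_distrl /= dT; field.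
  rewrite /Y big_distrr /=.
  transitivity (\sum_(u in [set: T]) 4^-1 * ((degree G u)%:R * (vol G (pblock P u))%:R) : R).
    apply: eq_big => [u|u _]; first by rewrite in_setT.
    rewrite /vol natr_sum !big_distrr /= [RHS]big_mkcond; apply: eq_bigr => v _ /=.
    have -> : (pblock P u == pblock P v) = (v \in pblock P u).
      by rewrite eq_pblock // cP inE.
    by case: (v \in _) => /=; ring.
  rewrite (set_partition_big _ PT) /=; apply: eq_bigr => A AP.
  rewrite -big_distrr /=; congr (_ * _).
  rewrite [RHS]expr2 [X in _ = X * _]natr_sum [RHS]big_distrl; apply: eq_bigr => u uA /=.
  by rewrite (def_pblock tP AP uA).
have := le_expct half01 (fun B _ => hc (U B)); rewrite expct_cst.
under eq_expct => B do rewrite mulrC [_ ^+ 2 / _]mulrC -mulNr.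
rewrite expctD !expctZ EX EY -/m /modularity_score -/m -/X -/Y => h.
rewrite -ler_pdivrMl //; apply: le_trans h.
rewrite le_eqVlt; apply/orP; left; apply/eqP; field.
by rewrite gt_eqF.
Qed.

End UnionOfParts.

(** * Modularity of the random graph *)

Section GnpLaw.
Variables (R : realType).
Implicit Types (p : R).

Lemma sum_edge_prob (T : finType) p (U : {set T}) :
  \sum_(e in [set e : {set T} | e \subset U]) edge_prob p e = p * 'C(#|U|, 2)%:R.
Proof.
rewrite -cards_draws -sum1_card natr_sum big_distrr big_mkcond [RHS]big_mkcond /=.
apply: eq_bigr => e _; rewrite !inE /edge_prob mulr1.
by case: (e \subset U); case: (#|e| == 2%N).
Qed.

Lemma edges_withinE (T : finType) (G : sgraph T) U :
  edges_within G U = #|edges G :&: [set e : {set T} | e \subset U]|.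
Proof. by apply: eq_card => e; rewrite !inE. Qed.

Lemma edges_setT (T : finType) (S : {set {set T}}) :
  S :&: [set e : {set T} | e \subset [set: T]] = S.
Proof. by apply/setP => e; rewrite !inE subsetT andbT. Qed.

Definition edge_event n (E : pred (sgraph 'I_n)) : pred {set {set 'I_n}} :=
  fun S => [exists G : sgraph 'I_n, (edges G == S) && E G].

Lemma Gnp_massE n p (G : sgraph 'I_n) : Gnp_mass p G = bmass (edge_prob p) (edges G).
Proof.
rewrite /Gnp_mass big_mkcond; apply: eq_bigr => e _; rewrite /edge_prob.
case: ifP => // e2; case: ifP => [/card_edge h|_]; first by rewrite h in e2.
by rewrite subr0.
Qed.

Lemma bmass_edges n p (S : {set {set 'I_n}}) :
  bmass (edge_prob p) S != 0 -> [forall e in S, #|e| == 2%N].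
Proof.
move=> nz; apply/forall_inP => e eS; apply: contraNT nz => e2.
by rewrite /bmass (bigD1 e) //= eS /edge_prob (negPf e2) mul0r.
Qed.

(** Sets of vertex sets that are not edge sets of graphs have mass 0, and the others correspond
    bijectively to graphs. *)
Lemma Gnp_probE n p (E : pred (sgraph 'I_n)) :
  Gnp_prob p E = prob (edge_prob p) (edge_event E).
Proof.
rewrite /prob /expct (bigID (fun S : {set {set 'I_n}} => [forall e in S, #|e| == 2%N])) /=.
rewrite [X in _ = _ + X]big1 ?addr0; last first.
  move=> S nS; have [->|/bmass_edges h] := eqVneq (bmass (edge_prob p) S) 0.
    by rewrite mul0r.
  by rewrite h in nS.
rewrite (reindex_omap (@edges _ : sgraph 'I_n -> _) insub) /=; last first.
  by move=> S vS; rewrite insubT.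
rewrite /Gnp_prob big_mkcond /=; apply: eq_big => [G|G _].
  by rewrite valK eqxx andbT; apply/esym/forall_inP => e /card_edge ->.
have -> : edge_event E (edges G) = E G.
  by apply/existsP/idP => [[H /andP[/eqP/val_inj->]]|EG]; [|exists G; rewrite eqxx].
by rewrite Gnp_massE; case: (E G); rewrite ?mulr1 ?mulr0.
Qed.

Lemma Gnp_prob_ge n p (E B : pred (sgraph 'I_n)) (x : R) : 0 <= p <= 1 ->
  (forall G, ~~ E G -> B G) -> prob (edge_prob p) (edge_event B) <= x ->
  1 - x <= Gnp_prob p E <= 1.
Proof.
move=> p01 EB Bx; have P01 := @edge_prob01 'I_n R p p01.
rewrite Gnp_probE prob_le1 // andbT lerBlDr -[leLHS](@expct_cst R _ (@edge_prob 'I_n R p)).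
apply: le_trans (lerD (lexx _) Bx); apply: le_trans (probU P01 _ _).
apply: le_expct => // S nz.
suff -> : edge_event E S || edge_event B S by [].
have h := bmass_edges nz; pose G := SGraph h.
case EG: (E G); first by apply/orP; left; apply/existsP; exists G; rewrite eqxx.
by apply/orP; right; apply/existsP; exists G; rewrite eqxx EB // EG.
Qed.

End GnpLaw.

(** * Lower bound: components of a subcritical subgraph *)

Section Sprinkling.
Variables (R : realType).
Implicit Types (p kappa nu c eps eta mu : R).

Lemma bin2_dbl n : 2 * 'C(n, 2)%:R = n%:R * (n%:R - 1) :> R.
Proof.
case: n => [|n]; first by rewrite bin0n mulr0 mul0r.
by rewrite -natrM -mul_bin_diag bin1 natrM -[n.+1%:R]natr1 addrK.
Qed.

Lemma expct_sqr_nbrs (T : finType) p (u : T) c : 0 <= p <= 1 -> p * #|T|%:R <= c ->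
  expct (edge_prob p) (fun S => #|nbrs S u (~: [set u])|%:R ^+ 2) <= p * #|T|%:R * (c + 1).
Proof.
move=> p01 pc; have /andP[p0 _] := p01; set V := ~: [set u].
have uV : u \notin V by rewrite !inE eqxx.
under eq_expct => S do rewrite card_nbrs.
apply: le_trans (expct_cardI_sqr (edge_prob01 p01) _) _; rewrite sum_star //.
have x0 : 0 <= p * #|V|%:R by rewrite mulr_ge0.
have xy : p * #|V|%:R <= p * #|T|%:R by rewrite ler_wpM2l // ler_nat max_card.
rewrite mulrDr mulr1; apply: lerD => //; rewrite expr2.
by apply: ler_pM => //; apply: le_trans pc.
Qed.

(** Deterministic part of the lower bound: [s] edges in the subgraph, [m] in all, and [x] for the
    sum bounding the squared volumes. The edge ratio loses at most [2 * eta], the volume term at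
    most [eta]. *)
Lemma ratio_bounds eta mu kappa (s m x : R) : 0 < eta -> eta <= 3^-1 -> 0 < mu -> kappa <= 1 ->
  0 <= s -> (kappa - eta) * mu <= s -> (1 - eta) * mu <= m -> m <= (1 + eta) * mu ->
  x <= eta * mu ^+ 2 -> kappa - 3 * eta <= s / m - (4 * m ^+ 2)^-1 * x.
Proof.
move=> e0 e3 mu0 k1 s0 sge mge mle xle.
have m23 : 2 / 3 * mu <= m by apply: le_trans mge; rewrite ler_wpM2r ?(ltW mu0) //; lra.
have m0 : 0 < m by lra.
have h1 : kappa - 2 * eta <= s / m.
  rewrite ler_pdivlMr //; have [kn|kp] := leP (kappa - 2 * eta) 0.
    by apply: le_trans s0; rewrite mulr_le0_ge0 // ltW.
  apply: le_trans sge; apply: le_trans (ler_wpM2l (ltW kp) mle) _.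
  rewrite mulrA ler_wpM2r ?(ltW mu0) //.
  have := mulr_ge0 (ltW e0) (ltW e0); have : 0 <= eta * (1 - kappa) by rewrite mulr_ge0 ?subr_ge0 // ltW.
  lra.
have h2 : (4 * m ^+ 2)^-1 * x <= eta.
  rewrite mulrC ler_pdivrMr ?mulr_gt0 ?exprn_gt0 //; apply: le_trans xle _.
  rewrite ler_wpM2l ?(ltW e0) //.
  have : (2 / 3 * mu) ^+ 2 <= m ^+ 2 by rewrite ler_pXn2r // nnegrE; lra.
  by have := sqr_ge0 mu; rewrite exprMn; lra.
lra.
Qed.

(** With [eta = eps / 3] and [mu] the mean number of edges, Chebyshev's inequality for the two edge
    counts costs [9 / (eps ^+ 2 * mu)] each, and Markov's inequality for the volume sum gives the
    other term. *)
Lemma prob_modularity_low n p kappa nu c eps :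
  (1 < n)%N -> 0 < p <= 1 -> 0 < kappa < 1 -> kappa * p * n%:R <= nu -> nu < 1 ->
  p * n%:R <= c -> 0 < eps <= 1 ->
  prob (edge_prob p) (edge_event (fun G : sgraph 'I_n => modularity R G < kappa - eps))
   <= (18 / eps ^+ 2 + 12 * (12 / (1 - nu) ^+ 2 + 2 * (c + 1) / (1 - nu)) / eps)
      / (p * 'C(n, 2)%:R).
Proof.
move=> n1 /andP[p0 p1] /andP[k0 k1] knu nu1 pc /andP[e0 e1].
set mu := p * _; set C := 12 / _ + _.
have N0 : 0 < 'C(n, 2)%:R :> R by rewrite ltr0n bin_gt0.
have mu0 : 0 < mu by rewrite mulr_gt0.
have nu1' : 0 < 1 - nu by rewrite subr_gt0.
have nN : n%:R ^+ 2 <= 4 * 'C(n, 2)%:R :> R.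
  have := bin2_dbl n; have : 2 <= n%:R :> R by rewrite ler_nat.
  by nra.
have kp1 : kappa * p <= kappa by rewrite ler_piMr // ltW.
have kpp : kappa * p <= p by rewrite ler_piMl // ltW.
have kp0 : 0 <= kappa * p by rewrite mulr_ge0 // ltW.
have d0 : 0 < 1 - kappa * p by rewrite subr_gt0 (le_lt_trans kp1).
(* Sprinkling density, the solution of [1 - p = (1 - kappa * p) * (1 - p2)]. *)
pose p2 := (p - kappa * p) / (1 - kappa * p).
have p2_0 : 0 <= p2 by rewrite divr_ge0 ?(ltW d0) // subr_ge0.
have p2p : p2 <= p.
  rewrite ler_pdivrMr // mulrBr mulr1 lerD2l lerN2 mulrCA -[leRHS]mulr1 -mulrA.
  by rewrite ler_wpM2l ?(ltW k0) // mulr1 ler_piMr // ltW.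
have P1 : 0 <= kappa * p <= 1 by rewrite kp0 (le_trans kpp).
have P2 : 0 <= p2 <= 1 by rewrite p2_0 (le_trans p2p).
have P01 : 0 <= p <= 1 by rewrite ltW.
have pU (e : {set 'I_n}) :
    1 - edge_prob p e = (1 - edge_prob (kappa * p) e) * (1 - edge_prob p2 e).
  by rewrite /edge_prob /p2; case: ifP => _; [field; rewrite gt_eqF | ring].
pose D := [set e : {set 'I_n} | e \subset [set: 'I_n]].
pose eta := eps / 3.
have eta0 : 0 < eta by rewrite divr_gt0.
pose V u := ~: [set u : 'I_n].
(* A degree in the union is at most the sum of the degrees in [S] and [S'], and
   [(y + z)^2 <= 2 y^2 + 2 z^2]. This splits the volume sum into a term of [S] alone and one where
   the sprinkled degree is independent of the component. *)
pose X1 S := \sum_u 2 * (#|nbrs S u (V u)|%:R ^+ 2 * #|component S u|%:R) : R.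
pose X2 S S' := \sum_u 2 * (#|component S u|%:R * #|nbrs S' u (V u)|%:R ^+ 2) : R.
pose b1 S : bool := eta * mu <= `|#|S :&: D|%:R - kappa * mu|.
pose b2 S : bool := eta * mu <= `|#|S :&: D|%:R - mu|.
(* Union bound with Markov's inequality built in, as a pointwise inequality between a sum and an
   indicator. *)
have bound S S' : (edge_event (fun G : sgraph 'I_n => modularity R G < kappa - eps) (S :|: S'))%:R
    <= (b1 S)%:R + ((b2 (S :|: S'))%:R + (eta * mu ^+ 2)^-1 * (X1 S + X2 S S')).
  have X0 : 0 <= X1 S + X2 S S'.
    by rewrite addr_ge0 // sumr_ge0 // => u _; rewrite !mulr_ge0 ?sqr_ge0.
  have em0 : 0 < eta * mu ^+ 2 by rewrite mulr_gt0 // exprn_gt0.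
  have X0' : 0 <= (eta * mu ^+ 2)^-1 * (X1 S + X2 S S') by rewrite mulr_ge0 // invr_ge0 ltW.
  rewrite /edge_event; case: existsP => [[G /andP[/eqP eG low]]|_]; last by rewrite addr_ge0 // addr_ge0.
  case B1: (b1 S); first by rewrite lerDl addr_ge0.
  case B2: (b2 _); first by rewrite add0r lerDl.
  rewrite !add0r leNgt; apply: contraL low; rewrite mulrC ltr_pdivrMr // mul1r => Xlt.
  move: B1 B2; rewrite /b1 /b2 /D !edges_setT => /negbT; rewrite -ltNge ltr_norml => /andP[s1 s2].
  move=> /negbT; rewrite -ltNge ltr_norml -eG -/(n_edges G) => /andP[m1 m2].
  have mge : (1 - eta) * mu <= (n_edges G)%:R by rewrite mulrBl mul1r; lra.
  have mG : n_edges G != 0%N.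
    rewrite -(pnatr_eq0 R) gt_eqF // (lt_le_trans _ mge) // mulr_gt0 // /eta; lra.
  rewrite -leNgt; apply: le_trans (modularity_ge_comp R mG (_ : S \subset edges G)); last first.
    by rewrite eG subsetUl.
  have -> : kappa - eps = kappa - 3 * eta by rewrite /eta; field.
  apply: (ratio_bounds (mu := mu)) => //.
  - by rewrite /eta; lra.
  - exact: ltW.
  - by rewrite mulrBl; lra.
  - by rewrite mulrDl mul1r; lra.
  apply: le_trans (ltW Xlt); rewrite /X1 /X2 -big_split; apply: ler_sum => u _ /=.
  have : (#|nbrs (edges G) u (V u)| <= #|nbrs S u (V u)| + #|nbrs S' u (V u)|)%N.
    rewrite eG -cardsUI (leq_trans _ (leq_addr _ _)) // subset_leq_card //.
    by apply/subsetP => x; rewrite !inE /adj inE => /andP[-> /orP[->|->]]; rewrite ?orbT.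
  rewrite -/(V u) -(ler_nat R) natrD.
  move: #|nbrs (edges G) u (V u)|%:R #|nbrs S u (V u)|%:R #|nbrs S' u (V u)|%:R
    (ler0n R #|nbrs (edges G) u (V u)|) (ler0n R #|component S u|) => x y z x0.
  move: #|component S u|%:R => w w0 xyz.
  have -> : 2 * (y ^+ 2 * w) + 2 * (w * z ^+ 2) = (2 * y ^+ 2 + 2 * z ^+ 2) * w by ring.
  rewrite ler_wpM2r //; apply: (@le_trans _ _ ((y + z) ^+ 2)).
    by rewrite ler_pXn2r // nnegrE (le_trans x0).
  by have := sqr_ge0 (y - z); rewrite sqrrB sqrrD; lra.
have E1 : expct (edge_prob (kappa * p)) X1 <= n%:R ^+ 2 * p * (12 / (1 - nu) ^+ 2).
  rewrite /X1 expct_sum.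
  apply: (@le_trans _ _ (\sum_(u : 'I_n) 2 * (6 * (kappa * p * n%:R) / (1 - nu) ^+ 2))).
    apply: ler_sum => u _; rewrite expctZ ler_wpM2l //.
    have h := @expct_sqr_nbrs_comp 'I_n R (kappa * p) (kappa * p * n%:R) u P1.
    rewrite card_ord in h; apply: le_trans (h _ _) _; rewrite ?lexx //.
      exact: le_lt_trans nu1.
    have i0 : 0 < 1 - kappa * p * n%:R by rewrite subr_gt0 (le_lt_trans knu).
    apply: ler_wpM2l; first by rewrite (mulr_ge0 _ (mulr_ge0 kp0 _)).
    rewrite lef_pV2 ?posrE ?exprn_gt0 //.
    by rewrite ler_pXn2r // ?nnegrE ?(ltW i0) ?(ltW nu1') // lerD2l lerN2.
  rewrite sumr_const card_ord -[leLHS]mulr_natr.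
  have -> : 2 * (6 * (kappa * p * n%:R) / (1 - nu) ^+ 2) * n%:R =
     kappa * p * (n%:R ^+ 2 * (12 / (1 - nu) ^+ 2)) by field; rewrite gt_eqF.
  rewrite [n%:R ^+ 2 * p]mulrC -[leRHS]mulrA ler_wpM2r //.
  by rewrite mulr_ge0 ?sqr_ge0 // divr_ge0 // sqr_ge0.
have E2 : expct (edge_prob (kappa * p)) (fun S => expct (edge_prob p2) (X2 S))
    <= n%:R ^+ 2 * p * (2 * (c + 1) / (1 - nu)).
  have c0 : 0 <= c by rewrite (le_trans _ pc) // mulr_ge0 // ltW.
  under eq_expct => S do rewrite expct_sum.
  rewrite expct_sum.
  apply: (@le_trans _ _ (\sum_(u : 'I_n) 2 * (p * n%:R * (c + 1) / (1 - nu)))).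
    apply: ler_sum => u _.
    under eq_expct => S do rewrite expctZ expctZ.
    rewrite expctZ ler_wpM2l //.
    under eq_expct => S do rewrite mulrC.
    rewrite expctZ; apply: ler_pM.
    - by apply: (expct_ge0 (edge_prob01 P2)) => S; rewrite sqr_ge0.
    - by apply: (expct_ge0 (edge_prob01 P1)) => S.
    - have h := @expct_sqr_nbrs 'I_n p2 u c P2; rewrite card_ord in h.
      apply: le_trans (h _) _; first by apply: le_trans pc; rewrite ler_wpM2r.
      by rewrite !ler_wpM2r ?addr_ge0.
    - by apply: expct_card_comp => //; rewrite card_ord.
  rewrite sumr_const card_ord -[leLHS]mulr_natr.
  by rewrite le_eqVlt; apply/orP; left; apply/eqP; field; rewrite gt_eqF.
rewrite /prob (expct_setU _ pU).
apply: le_trans (le_expct (edge_prob01 P1) (fun S _ => le_expct (edge_prob01 P2) (fun S' _ => bound S S'))) _.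
under eq_expct => S do rewrite expctD expct_cst expctD expctZ expctD expct_cst.
rewrite expctD expctD expctZ expctD.
rewrite -(expct_setU (fun S => (b2 S)%:R) pU).
have C1 := chebyshev_cardI (edge_prob01 P1) D (mulr_gt0 eta0 mu0).
have C2 := chebyshev_cardI (edge_prob01 P01) D (mulr_gt0 eta0 mu0).
have S1 : \sum_(e in D) edge_prob (kappa * p) e = kappa * mu.
  by rewrite sum_edge_prob cardsT card_ord mulrA.
have S2 : \sum_(e in D) edge_prob p e = mu by rewrite sum_edge_prob cardsT card_ord.
rewrite S1 in C1; rewrite S2 in C2.
apply: le_trans (lerD C1 (lerD C2 (ler_wpM2l _ (lerD E1 E2)))) _.
  by rewrite invr_ge0 mulr_ge0 ?sqr_ge0 // ltW.
have -> : n%:R ^+ 2 * p * (12 / (1 - nu) ^+ 2) + n%:R ^+ 2 * p * (2 * (c + 1) / (1 - nu)) =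
   n%:R ^+ 2 * p * C by rewrite -mulrDr.
have C0 : 0 <= C.
  have c0 : 0 <= c by rewrite (le_trans _ pc) // mulr_ge0 // ltW.
  by apply: addr_ge0; apply: divr_ge0; rewrite ?sqr_ge0 ?(ltW nu1') //; lra.
have h1 : n%:R ^+ 2 * p * C <= 4 * mu * C.
  have -> : 4 * mu = 4 * 'C(n, 2)%:R * p by rewrite /mu; ring.
  by rewrite ler_wpM2r // ler_wpM2r // ltW.
apply: (@le_trans _ _ (mu / (eta * mu) ^+ 2 + (mu / (eta * mu) ^+ 2 + (eta * mu ^+ 2)^-1 * (4 * mu * C)))).
  apply: lerD; last apply: lerD => //.
    by rewrite ler_wpM2r ?invr_ge0 ?sqr_ge0 // ler_piMl // ltW.
  by rewrite ler_wpM2l // invr_ge0 mulr_ge0 ?sqr_ge0 // ltW.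
rewrite /eta; move: C C0 {h1 E1 E2 bound} => C C0.
rewrite le_eqVlt; apply/orP; left; apply/eqP; field.
by rewrite !gt_eqF.
Qed.

End Sprinkling.

(** * Upper bound for bounded average degree *)

Section GiantComponent.
Variables (R : realType).
Implicit Types (p s : R).

(** Weight each [F] by [expR (th * (K - #|F|))], at least 1 on the sets summed over; the sum over
    all sets then factorizes, and [1 + x <= expR x]. *)
Lemma sum_prod_subset (I : finType) (y : I -> R) (th K : R) :
  (forall i, 0 <= y i) -> 0 <= th ->
  \sum_(F : {set I} | #|F|%:R <= K) \prod_(i in F) y i
    <= expR (th * K + expR (- th) * \sum_i y i).
Proof.
move=> y0 th0; have z0 := expR_ge0 (- th).
apply: (@le_trans _ _ (\sum_(F : {set I}) expR (th * K) * \prod_(i in F) (expR (- th) * y i))).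
  rewrite [leLHS]big_mkcond; apply: ler_sum => F _.
  have P0 : 0 <= \prod_(i in F) y i by apply: prodr_ge0.
  case: ifP => FK; last by rewrite mulr_ge0 ?expR_ge0 // prodr_ge0 // => i _; rewrite mulr_ge0.
  rewrite big_split prodr_const -expRM_natl mulrA -expRD -[leLHS]mul1r ler_wpM2r //.
  have : 0 <= th * (K - #|F|%:R) by rewrite mulr_ge0 // subr_ge0.
  have := expR_ge1Dx (th * K + #|F|%:R * - th).
  lra.
rewrite -big_distrr expRD ler_wpM2l ?expR_ge0 //=.
have -> : \sum_(F : {set I}) \prod_(i in F) (expR (- th) * y i) = \prod_i (expR (- th) * y i + 1).
  by rewrite bigA_distr; apply: eq_bigr => F _; rewrite big_mkcond.
rewrite big_distrr expR_sum; apply: ler_prod => i _.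
by rewrite addr_ge0 ?mulr_ge0 //= addrC expR_ge1Dx.
Qed.

(** The supermartingale with [a = expR (- t)] and [b = expR (- t ^+ 2)], stopped when a proportion
    [1 - t] of the vertices is undiscovered. The choice of [t] means [(1 + s) * (1 - 3 * t) = 1],
    which gives the drift condition [(1 + s) * (1 - t) ^+ 2 >= 1 + t]. *)
Lemma prob_small_comps_exp (T : finType) p s (t L : R) :
  t = s / (3 * (1 + s)) -> 0 < s -> 0 <= p <= 1 ->
  1 + s <= p * #|T|%:R -> 0 <= L ->
  prob (edge_prob p) (fun S : {set {set T}} => [forall r, #|component S r|%:R <= L])
    <= expR (t * L - t ^+ 3 * #|T|%:R).
Proof.
move=> tE s0 p01 ps L0; have /andP[p0 p1] := p01; set n := #|T|%:R : R.
have n0 : 0 < n.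
  rewrite /n ltr0n lt0n; apply/eqP => e; move: ps; rewrite e mulr0; lra.
have t0 : 0 < t by rewrite tE divr_gt0 // mulr_gt0 // addr_gt0.
have t3 : 3 * t * (1 + s) = s by rewrite tE; field; lra.
have t1 : 3 * t < 1 by nra.
pose a := expR (- t); pose b := expR (- t ^+ 2); pose w0 := Num.truncn ((1 - t) * n).
have w0le : w0%:R <= (1 - t) * n by rewrite truncn_le mulr_ge0 //; lra.
have w0lt w : (w0 < w)%N -> (1 - t) * n < w%:R.
  by move=> h; apply: lt_le_trans (truncnS_gt _) _; rewrite ler_nat.
pose K := expR (t * L + t ^+ 2 * w0%:R).
have expX x k : expR x ^+ k = expR (k%:R * x) by rewrite expRM_natl.
have -> : expR (t * L - t ^+ 3 * n) = expR (t * L + t ^+ 2 * ((1 - t) * n)) * b ^+ #|T|.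
  by rewrite /b expX -expRD -/n; congr expR; ring.
apply: (@le_trans _ _ (K * b ^+ #|T|)); last first.
  by rewrite ler_wpM2r ?exprn_ge0 ?expR_ge0 // ler_expR lerD2l ler_wpM2l ?sqr_ge0.
apply: (prob_small_comps (a := a) (w0 := w0) p01) => //.
- by rewrite /a /b expR_ge0 ler_expR lerN2; nra.
- exact: expR_gt0.
- exact: expR_ge0.
- move=> q w qL ww0; rewrite /K /a /b !expX -!expRD.
  rewrite -[leLHS]expR0 ler_expR.
  have : q%:R * t <= L * t by rewrite ler_wpM2r // ltW.
  have : w%:R * t ^+ 2 <= w0%:R * t ^+ 2 by rewrite ler_wpM2r ?sqr_ge0 // ler_nat.
  lra.
move=> w /andP[/w0lt ww _].
pose x := t - t ^+ 2.
have x0 : 0 < x by rewrite /x; nra.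
have -> : a / b = expR (- x) by rewrite /a /b -expRN -expRD; congr expR; rewrite /x; ring.
have ex : x / (1 + x) <= 1 - expR (- x).
  have h := expR_ge1Dx x; rewrite expRN.
  have -> : x / (1 + x) = 1 - (1 + x)^-1 by field; lra.
  by rewrite lerD2l lerN2 lef_pV2 ?posrE ?expR_gt0 //; lra.
have ex' : t * (1 - t) / (1 + t) <= 1 - expR (- x).
  apply: le_trans ex.
  have -> : t * (1 - t) = x by rewrite /x; ring.
  by rewrite ler_wpM2l ?(ltW x0) // lef_pV2 ?posrE; rewrite ?/x; nra.
(* Before stopping, [p * w] is at least [(1 + s) * (1 - t)]; this is where supercriticality
   enters. *)
have key : t <= p * w%:R * (1 - expR (- x)).
  apply: (@le_trans _ _ ((1 + s) * (1 - t) * (t * (1 - t) / (1 + t)))).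
    rewrite !mulrA ler_pdivlMr; last lra.
    have : 0 <= t * (s * t ^+ 2) by rewrite !mulr_ge0 ?sqr_ge0 // ltW.
    have -> : (1 + s) * (1 - t) * t * (1 - t) = t * ((1 + s) * (1 - t) ^+ 2) by ring.
    rewrite ler_pM2l //; nra.
  apply: ler_pM => //.
  - by rewrite mulr_ge0; lra.
  - by rewrite divr_ge0 ?mulr_ge0; lra.
  apply: (@le_trans _ _ (p * n * (1 - t))); first by rewrite ler_wpM2r //; lra.
  by rewrite -mulrA ler_wpM2l // mulrC ltW.
apply: (@le_trans _ _ (expR (- (p * (1 - expR (- x)))) ^+ w)).
  rewrite lerXn2r // ?nnegrE ?expR_ge0 //.
    by rewrite addr_ge0 ?mulr_ge0 ?expR_ge0 // subr_ge0.
  by apply: le_trans (expR_ge1Dx _); lra.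
by rewrite expX /a ler_expR; lra.
Qed.

(** Outside a Chebyshev event there are at most [c1 * n] edges. A union bound over the deleted set
    [F] then uses the likelihood ratio of [F] and the exponential bound for small components. The
    value of [r] makes each of the three losses at most [t ^+ 3 / 4 * n], up to the additive [t],
    against a gain of [t ^+ 3 * n]. *)
Lemma prob_modularity_high n p s (c1 t r : R) : t = s / (3 * (1 + s)) -> r = t ^+ 3 / (8 * c1) ->
  (1 < n)%N -> 0 < s -> 0 <= p -> p <= 2^-1 ->
  1 + s <= p * n%:R -> p * n%:R <= c1 ->
  prob (edge_prob p) (edge_event (fun G : sgraph 'I_n => 1 - r ^+ 2 < modularity R G))
    <= 2 / (c1 * n%:R) + expR (t - t ^+ 3 / 4 * n%:R).
Proof.
move=> tE rE n1 s0 p0 p2 ps pc.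
have p01 : 0 <= p <= 1 by rewrite p0 (le_trans p2) // invf_le1 // ler1n.
have P01 := @edge_prob01 'I_n R p p01.
have n0 : 0 < n%:R :> R by rewrite ltr0n (leq_trans _ n1).
have c1_1 : 1 < c1 by lra.
have t0 : 0 < t by rewrite tE divr_gt0 // mulr_gt0 // addr_gt0.
have t3 : 3 * t * (1 + s) = s by rewrite tE; field; lra.
have t1 : 3 * t < 1 by nra.
have r0 : 0 < r by rewrite rE divr_gt0 ?exprn_gt0 // mulr_gt0 //; lra.
have rc : 8 * c1 * r = t ^+ 3 by rewrite rE; field; lra.
have t31 : t ^+ 3 < 1 by rewrite exprn_ilt1 ?ltW //; lra.
have r1 : r < 1 by nra.
pose D := [set e : {set 'I_n} | e \subset [set: 'I_n]].
pose mu := p * 'C(n, 2)%:R; pose d := c1 * n%:R / 2.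
have d0 : 0 < d by rewrite /d divr_gt0 // mulr_gt0 //; lra.
have mud : mu <= d.
  have := bin2_dbl R n; rewrite /mu /d => e.
  have -> : 'C(n, 2)%:R = n%:R * (n%:R - 1) / 2 :> R by lra.
  have : p * n%:R * (n%:R - 1) <= c1 * (n%:R - 1).
    by rewrite ler_wpM2r // subr_ge0 ler1n ltnW.
  lra.
pose many S : bool := d <= `|#|S :&: D|%:R - mu|.
pose L := 1 + 2 * r * (c1 * n%:R); pose K := r ^+ 2 * (c1 * n%:R).
pose small := fun S : {set {set 'I_n}} => [forall v, #|component S v|%:R <= L].
apply: le_trans (le_prob P01 (E' := fun S => many S ||
    [exists F : {set {set 'I_n}}, (#|F|%:R <= K) && ((F \subset S) && small (S :\: F))]) _) _.
  move=> S _ /existsP[G /andP[/eqP <- high]].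
  have n0' : (0 < #|'I_n|)%N by rewrite card_ord ltnW.
  case mG: (many _) => //=; move: mG; rewrite /many edges_setT -/(n_edges G) => /negbT.
  rewrite -ltNge ltr_norml => /andP[_ mlt].
  have mle : (n_edges G)%:R <= c1 * n%:R by move: mlt mud; rewrite /d; lra.
  have [P /and3P[mG PT sc]] : exists P, [&& n_edges G != 0%N, finset.partition P [set: 'I_n] &
      1 - r ^+ 2 <= modularity_score R G P].
    apply/existsP; apply: contraLR high; rewrite negb_exists -leNgt => /forallP h.
    apply: modularity_le => // [|P mG PT]; first by rewrite subr_ge0 exprn_ile1 // ltW.
    by have := h P; rewrite mG PT /= -ltNge => /ltW.
  have [F [FG Fle Fc]] := modularity_score_ge mG PT (ltW r0) sc.
  apply/existsP; exists F; rewrite FG /=; apply/andP; split.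
    by apply: le_trans Fle _; rewrite /K ler_wpM2l ?sqr_ge0.
  apply/forallP => v; apply: le_trans (Fc v) _; rewrite /L lerD2l ler_wpM2l // ltW //.
  by rewrite mulr_gt0.
apply: le_trans (probU P01 _ _) _; apply: lerD.
  have := chebyshev_cardI P01 D d0.
  have -> : \sum_(e in D) edge_prob p e = mu by rewrite sum_edge_prob cardsT card_ord.
  move=> ch; apply: le_trans ch _.
  have -> : 2 / (c1 * n%:R) = d / d ^+ 2.
    by rewrite /d; field; rewrite !gt_eqF //; lra.
  by rewrite ler_wpM2r ?invr_ge0 ?sqr_ge0.
have P1 e : edge_prob p e < 1 :> R by rewrite /edge_prob; case: ifP => _ //; lra.
apply: le_trans (prob_exists P01 _ _) _.
apply: (@le_trans _ _ (\sum_(F : {set {set 'I_n}} | #|F|%:R <= K)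
   prob (edge_prob p) small * \prod_(e in F) (edge_prob p e / (1 - edge_prob p e)))).
  by apply: ler_sum => F _; apply: prob_setD.
rewrite -big_distrr /=.
pose y (e : {set 'I_n}) := edge_prob p e / (1 - edge_prob p e).
have y0 e : 0 <= y e by rewrite divr_ge0 ?subr_ge0 ?(ltW (P1 e)) //; case/andP: (P01 e).
(* Chosen so that [expR (- th) <= 1 / th] makes the product over all pairs cost at most
   [t ^+ 3 / 4 * n] in the exponent, while [th * K] is still only [t ^+ 3 / 16 * n]. *)
pose th := 4 * c1 / t ^+ 3.
have th0 : 0 < th by rewrite divr_gt0 ?exprn_gt0 ?mulr_gt0 //; lra.
have hs := sum_prod_subset K y0 (ltW th0).
(* Since [p <= 1/2], the odds [p / (1 - p)] are at most [2 * p]. *)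
have sy : \sum_e y e <= c1 * n%:R.
  apply: (@le_trans _ _ (2 * mu)); last by move: mud; rewrite /d; lra.
  have -> : mu = \sum_(e in D) edge_prob p e by rewrite sum_edge_prob cardsT card_ord.
  rewrite big_distrr /= [leRHS]big_mkcond; apply: ler_sum => e _.
  rewrite inE subsetT /y /edge_prob; case: ifP => _; last by rewrite mul0r mulr0.
  rewrite ler_pdivrMr; last lra.
  nra.
have eth : expR (- th) * (c1 * n%:R) <= t ^+ 3 / 4 * n%:R.
  rewrite mulrA ler_wpM2r // expRN mulrC ler_pdivrMr ?expR_gt0 //.
  have h : th <= expR th by apply: le_trans (expR_ge1Dx th); lra.
  apply: le_trans (ler_wpM2l _ h); last by rewrite divr_ge0 // exprn_ge0 // ltW.
  by rewrite le_eqVlt /th; apply/orP; left; apply/eqP; field; lra.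
have thK : th * K <= t ^+ 3 / 4 * n%:R.
  have -> : th * K = t ^+ 3 / 16 * n%:R by rewrite /th /K rE; field; lra.
  by rewrite ler_wpM2r // ler_wpM2l ?exprn_ge0 // ?ltW //; lra.
have tL : t * L <= t + t ^+ 3 / 4 * n%:R.
  have -> : t * L = t + t * (t ^+ 3 / 4 * n%:R) by rewrite /L rE; field; lra.
  rewrite lerD2l ler_piMl //; last lra.
  by rewrite mulr_ge0 // divr_ge0 // exprn_ge0 // ltW.
have L0 : 0 <= L by rewrite addr_ge0 // !mulr_ge0 ?ltW //; lra.
have hsm := @prob_small_comps_exp 'I_n p s t L tE s0 p01.
rewrite card_ord in hsm; have {}hsm := hsm ps L0.
apply: le_trans (ler_pM (prob_ge0 P01 _) _ hsm hs) _.
  by apply: sumr_ge0 => F _; apply: prodr_ge0.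
rewrite -expRD ler_expR.
have : expR (- th) * \sum_e y e <= expR (- th) * (c1 * n%:R) by rewrite ler_wpM2l ?expR_ge0.
lra.
Qed.

End GiantComponent.

(** * Upper bound for growing average degree *)

Section DenseGraphs.
Variables (R : realType).

(** Markov's inequality for the exponential moment, with each factor bounded by
    [1 + x <= expR x]. *)
Lemma chernoff_cardI (I : finType) (P : I -> R) (D : {set I}) (la r : R) :
  (forall i, 0 <= P i <= 1) -> 0 <= la ->
  prob P (fun A => r <= #|A :&: D|%:R) <= expR ((expR la - 1) * \sum_(i in D) P i - la * r).
Proof.
move=> P01 la0; have z0 := expR_gt0 (la * r).
apply: (@le_trans _ _ (expct P (fun A => expR la ^+ #|A :&: D|) / expR (la * r))).
  apply: le_trans (markov_prob P01 z0 _); last by move=> A; rewrite exprn_ge0 ?expR_ge0.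
  by apply: le_prob => // A _ h; rewrite -expRM_natl ler_expR mulrC ler_wpM2r.
rewrite expct_expcard expRD expRN ler_wpM2r ?invr_ge0 ?expR_ge0 //.
rewrite big_distrr expR_sum; apply: ler_prod => i _; have /andP[P0 P1] := P01 i.
apply/andP; split; first by rewrite addr_ge0 ?subr_ge0 ?mulr_ge0 ?expR_ge0.
by apply: le_trans (expR_ge1Dx _); rewrite /=; lra.
Qed.

Lemma expR_le_quadratic (x : R) : 0 <= x <= 2^-1 -> expR x <= 1 + x + 2 * x ^+ 2.
Proof.
move=> /andP[x0 x1]; rewrite -[x in expR x]opprK expRN.
apply: (@le_trans _ _ (1 - x)^-1).
  by rewrite lef_pV2 ?posrE ?expR_gt0 ?expR_ge1Dx //; lra.
have h : 0 < 1 - x by lra.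
rewrite -[leLHS]mul1r ler_pdivrMr //.
by have := mulr_ge0 (sqr_ge0 x) (_ : 0 <= 1 - 2 * x); rewrite subr_ge0; nra.
Qed.

(* Here [u = e(U)], [v = e(~U)], [al = #|U| / n] and [vol(U) = m + u - v]; the square of
   the volume is bounded below by its tangent at [2 al m], its quasirandom value. *)
Lemma quasirandom_bound (u v m M al eta : R) :
  0 < m -> 0 < M -> 0 < eta -> eta <= 4^-1 -> 0 <= al <= 1 ->
  u <= M * (al ^+ 2 + eta) -> v <= M * ((1 - al) ^+ 2 + eta) -> (1 - 2 * eta) * M <= m ->
  u / m - (m + u - v) ^+ 2 / (4 * m ^+ 2) <= 3 * eta.
Proof.
move=> m0 M0 e0 e4 /andP[a0 a1] hu hv hm; set w := m + u - v.
have -> : u / m - w ^+ 2 / (4 * m ^+ 2) = (4 * m * u - w ^+ 2) / (4 * m ^+ 2).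
  by field; rewrite gt_eqF.
rewrite ler_pdivrMr ?mulr_gt0 ?exprn_gt0 //.
have h1 : 4 * m * (al * w) - 4 * m * (al ^+ 2 * m) <= w ^+ 2.
  have := sqr_ge0 (w - 2 * al * m); rewrite sqrrB; lra.
(* The leading terms of [(1 - al) * u + al * v] add up to [al * (1 - al) * M] and cancel against
   [m]. What remains is at most [3/2 * eta * M], and [M <= 2 * m]. *)
have h2 : u - al * w + al ^+ 2 * m <= 3 * eta * m.
  have -> : u - al * w + al ^+ 2 * m = (1 - al) * u + al * v - al * (1 - al) * m.
    by rewrite /w; ring.
  have k1 : (1 - al) * u <= (1 - al) * (M * (al ^+ 2 + eta)) by rewrite ler_wpM2l // subr_ge0.
  have k2 : al * v <= al * (M * ((1 - al) ^+ 2 + eta)) by rewrite ler_wpM2l.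
  have b0 : 0 <= al * (1 - al) by rewrite mulr_ge0 // subr_ge0.
  have k3 : al * (1 - al) * ((1 - 2 * eta) * M) <= al * (1 - al) * m by rewrite ler_wpM2l.
  have b4 : al * (1 - al) <= 4^-1 by have := sqr_ge0 (al - 2^-1); rewrite sqrrB; lra.
  have k4 : al * (1 - al) * (eta * M) <= 4^-1 * (eta * M).
    by rewrite ler_wpM2r // mulr_ge0 // ltW.
  have k5 : 0 <= eta * (m - 2^-1 * M).
    apply: mulr_ge0; first exact: ltW.
    have : 0 <= (4^-1 - eta) * M by rewrite mulr_ge0 ?subr_ge0 // ltW.
    lra.
  lra.
have : 4 * m * (u - al * w + al ^+ 2 * m) <= 4 * m * (3 * eta * m).
  by rewrite ler_wpM2l // mulr_ge0 // ltW.
lra.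
Qed.

(** One [1 / n] comes from Chebyshev's inequality for the number of edges. The other is a union
    bound over all vertex sets [U]: each has too many inner edges with probability at most
    [expR (- (2 * n))], and [2 ^ n <= expR n]. The factor 12 is 4 from the random union times 3 from
    [quasirandom_bound]. *)
Lemma prob_modularity_dense n (p eta : R) : (1 < n)%N -> 0 < p <= 1 -> 0 < eta <= 4^-1 ->
  1 <= eta * n%:R -> 32 <= eta ^+ 2 * (n%:R * p) ->
  prob (edge_prob p) (edge_event (fun G : sgraph 'I_n => 12 * eta < modularity R G))
    <= n%:R^-1 + n%:R^-1.
Proof.
move=> n1 /andP[p0 p1] /andP[e0 e4] en enp.
have p01 : 0 <= p <= 1 by rewrite ltW.
have P01 := @edge_prob01 'I_n R p p01.
have n0 : 0 < n%:R :> R by rewrite ltr0n ltnW.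
pose M := p * n%:R ^+ 2 / 2.
have M0 : 0 < M by rewrite divr_gt0 // mulr_gt0 // exprn_gt0.
pose mu := p * 'C(n, 2)%:R.
have muE : mu = M - p * n%:R / 2.
  have := bin2_dbl R n; rewrite /mu /M => e.
  by have -> : 'C(n, 2)%:R = n%:R * (n%:R - 1) / 2 :> R; [lra | ring].
have muM : (1 - eta) * M <= mu <= M.
  have pn0 : 0 <= p * n%:R by rewrite mulr_ge0 // ltW.
  have : p * n%:R * 1 <= p * n%:R * (eta * n%:R) by rewrite ler_wpM2l.
  rewrite muE /M; lra.
pose D := [set e : {set 'I_n} | e \subset [set: 'I_n]].
pose few S : bool := eta * M <= `|#|S :&: D|%:R - mu|.
pose bnd (U : {set 'I_n}) : R := M * ((#|U|%:R / n%:R) ^+ 2 + eta).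
pose big U (S : {set {set 'I_n}}) : bool := bnd U <= #|S :&: [set e : {set 'I_n} | e \subset U]|%:R.
have eM0 : 0 < eta * M by rewrite mulr_gt0.
apply: le_trans (le_prob P01 (E' := fun S => few S || [exists U, true && big U S]) _) _.
  move=> S _ /existsP[G /andP[/eqP <- high]].
  case mG: (few _) => //=; move: mG; rewrite /few edges_setT -/(n_edges G) => /negbT.
  rewrite -ltNge ltr_norml => /andP[mlt _].
  have mge : (1 - 2 * eta) * M <= (n_edges G)%:R by move: mlt muM => + /andP[]; lra.
  have m0 : 0 < (n_edges G)%:R :> R.
    by apply: lt_le_trans mge; rewrite mulr_gt0 //; lra.
  apply: contraLR high; rewrite negb_exists -leNgt => /forallP h.
  have hU U : (edges_within G U)%:R <= bnd U.
    by have := h U; rewrite /= /big -ltNge edges_withinE => /ltW.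
  apply: modularity_le => [||P mG PT]; first by rewrite card_ord ltnW.
    by rewrite mulr_ge0 // ltW.
  have -> : 12 * eta = 4 * (3 * eta) by ring.
  apply: score_le_union => // U.
  have -> : (vol G U)%:R = (n_edges G)%:R + (edges_within G U)%:R - (edges_within G (~: U))%:R :> R.
    by rewrite -natrD -vol_setC natrD addrK.
  apply: (quasirandom_bound (M := M) (al := #|U|%:R / n%:R)) => //.
    by rewrite divr_ge0 ?ler_pdivrMr // mul1r ler_nat -[X in (_ <= X)%N](card_ord n) max_card.
  apply: le_trans (hU _) _; rewrite /bnd.
  have -> : #|~: U|%:R = n%:R - #|U|%:R :> R.
    by have := cardsC U; rewrite card_ord => /(congr1 (fun k => k%:R : R)); rewrite natrD; lra.
  by rewrite mulrBl divff // gt_eqF.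
apply: le_trans (probU P01 _ _) _; apply: lerD.
  have := chebyshev_cardI P01 D eM0.
  have -> : \sum_(e in D) edge_prob p e = mu by rewrite sum_edge_prob cardsT card_ord.
  move=> ch; apply: le_trans ch _.
  rewrite ler_pdivrMr ?exprn_gt0 //.
  apply: le_trans (_ : _ <= M) _; first by case/andP: muM.
  rewrite mulrC ler_pdivlMr // exprMn expr2 mulrA mulrC ler_wpM2r ?(ltW M0) //.
  have -> : eta ^+ 2 * M = eta ^+ 2 * (n%:R * p) * (n%:R / 2) by rewrite /M; field.
  nra.
apply: le_trans (prob_exists P01 _ _) _.
apply: (@le_trans _ _ (\sum_(U : {set 'I_n}) expR (- (2 * n%:R)))).
  (* This value minimizes the exponent [(2 * la ^+ 2 - la * eta) * M], giving
     [- (eta ^+ 2 / 8 * M)]. *)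
  apply: ler_sum => U _; pose la := eta / 4.
  have la0 : 0 <= la by rewrite divr_ge0 // ltW.
  apply: le_trans (chernoff_cardI _ _ P01 la0) _; rewrite ler_expR sum_edge_prob.
  have hq := @expR_le_quadratic la _.
  set a := #|U|%:R : R.
  have an : a <= n%:R by rewrite /a ler_nat -[X in (_ <= X)%N](card_ord n) max_card.
  have a0 : 0 <= a by [].
  have a2 : a ^+ 2 <= n%:R ^+ 2 by rewrite ler_pXn2r // nnegrE ltW.
  have C2 : 'C(#|U|, 2)%:R <= a ^+ 2 / 2 by have := bin2_dbl R #|U|; rewrite -/a; lra.
  have x0 : 0 <= p * 'C(#|U|, 2)%:R by rewrite mulr_ge0 // ltW.
  have s1 : (expR la - 1) * (p * 'C(#|U|, 2)%:R) <= (la + 2 * la ^+ 2) * (p * (a ^+ 2 / 2)).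
    apply: ler_pM => //; first by rewrite subr_ge0 -expR0 ler_expR.
      have := hq; rewrite la0 /= => /(_ _) h.
      have : expR la <= 1 + la + 2 * la ^+ 2 by apply: h; rewrite /la; lra.
      lra.
    by rewrite ler_wpM2l // ltW.
  have bE : bnd U = p * (a ^+ 2 / 2) + eta * M.
    by rewrite /bnd -/a /M; field; rewrite gt_eqF.
  rewrite bE; apply: le_trans (lerB s1 (lexx _)) _.
  have s2 : 2 * la ^+ 2 * (p * (a ^+ 2 / 2)) <= 2 * la ^+ 2 * M.
    have pa : p * (a ^+ 2 / 2) <= M by rewrite /M; have := ler_wpM2l (ltW p0) a2; lra.
    by rewrite ler_wpM2l // mulr_ge0 ?sqr_ge0.
  have s3 : 2 * n%:R <= eta ^+ 2 / 8 * M.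
    have -> : eta ^+ 2 / 8 * M = eta ^+ 2 * (n%:R * p) * n%:R / 16 by rewrite /M; field.
    have : 32 * n%:R <= eta ^+ 2 * (n%:R * p) * n%:R by rewrite ler_wpM2r // ltW.
    lra.
  have : 2 * la ^+ 2 * M - la * (eta * M) = - (eta ^+ 2 / 8 * M) by rewrite /la; field.
  lra.
have cS : #|{set 'I_n}| = (2 ^ n)%N.
  by rewrite -cardsT -powersetT card_powerset cardsT card_ord.
rewrite sumr_const cS -[leLHS]mulr_natr natrX.
have -> : expR (- (2 * n%:R)) = expR (- 1) ^+ n * expR (- n%:R) :> R.
  by rewrite -expRM_natl -expRD; congr expR; ring.
rewrite mulrAC -exprMn.
have e1 : expR (- 1) * 2 <= 1 :> R.
  by rewrite expRN mulrC ler_pdivrMr ?expR_gt0 // mul1r; have := expR_ge1Dx (1 : R); lra.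
have e2 : (expR (- 1) * 2) ^+ n <= 1 :> R by rewrite exprn_ile1 // mulr_ge0 // expR_ge0.
apply: le_trans (ler_wpM2r (expR_ge0 _) e2) _; rewrite mul1r expRN.
by rewrite lef_pV2 ?posrE ?expR_gt0 //; have := expR_ge1Dx (n%:R : R); lra.
Qed.

End DenseGraphs.

From mathcomp Require Import all_classical all_reals all_analysis.
Import numFieldNormedType.Exports.

Local Open Scope classical_set_scope.
Local Open Scope ring_scope.

(** * Passage to the limit *)

Section Limits.
Variable R : realType.

Lemma near_div_le (K eps : R) (f : nat -> R) : 0 < eps -> f @ \oo --> +oo ->
  \forall n \near \oo, K / f n <= eps.
Proof.
move=> e0 fy; near=> n.
have f1 : 1 <= f n by near: n; move/cvgryPge: fy; exact.
have fK : K / eps <= f n by near: n; move/cvgryPge: fy; exact.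
by rewrite ler_pdivrMr ?(lt_le_trans ltr01) // mulrC -ler_pdivrMr.
Unshelve. all: by end_near. Qed.

Lemma cvg_natr_pinfty : (fun n => n%:R : R) @ \oo --> +oo.
Proof. by apply/cvgryPge => A; exact: nbhs_infty_ger. Qed.

Definition negligible (p : nat -> R) (B : forall n, pred (sgraph 'I_n)) : Prop :=
  forall eps : R, 0 < eps ->
    \forall n \near \oo, prob (edge_prob (p n)) (edge_event (B n)) <= eps.

Lemma whp_negligible (p : nat -> R) (E B B' : forall n, pred (sgraph 'I_n)) :
  (forall n, 0 < p n <= 1) ->
  (\forall n \near \oo, forall G, ~~ E n G -> B n G || B' n G) ->
  negligible p B -> negligible p B' -> whp p E.
Proof.
move=> p01 EB nB nB'; apply/cvgrPdist_le => eps e0.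
have e2 : 0 < eps / 2 by rewrite divr_gt0.
near=> n.
have /andP[p0 p1] := p01 n; have pn : 0 <= p n <= 1 by rewrite (ltW p0).
have P01 := edge_prob01 (T := 'I_n) pn.
have h : prob (edge_prob (p n)) (edge_event (fun G => B n G || B' n G)) <= eps.
  apply: le_trans (_ : _ <= eps / 2 + eps / 2) _; last by rewrite -splitr.
  apply: le_trans (lerD (_ : prob (edge_prob (p n)) (edge_event (B n)) <= _)
    (_ : prob (edge_prob (p n)) (edge_event (B' n)) <= _)); last 2 first.
  - by near: n; exact: nB.
  - by near: n; exact: nB'.
  apply: le_trans (probU P01 _ _); apply: le_prob => // S _ /existsP[G /andP[GS /orP[b|b]]].
    by apply/orP; left; apply/existsP; exists G; rewrite GS.
  by apply/orP; right; apply/existsP; exists G; rewrite GS.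
have EBn : forall G, ~~ E n G -> B n G || B' n G by near: n.
have /andP[h1 h2] := Gnp_prob_ge pn EBn h.
by rewrite ger0_norm ?subr_ge0 // lerBlDr -lerBlDl.
Unshelve. all: by end_near. Qed.

(** The bound is a constant over the mean number of edges, which is at least [n ^+ 2 * p / 4] and so
    tends to infinity. *)
Lemma negligible_low (p : nat -> R) (kappa nu c eps : R) :
  (forall n, 0 < p n <= 1) -> (fun n => n%:R ^+ 2 * p n) @ \oo --> +oo ->
  0 < kappa < 1 -> nu < 1 -> 0 < eps <= 1 ->
  (\forall n \near \oo, kappa * p n * n%:R <= nu /\ p n * n%:R <= c) ->
  negligible p (fun n G => modularity R G < kappa - eps).
Proof.
move=> p01 n2p k01 nu1 e01 kn del d0.
pose K : R := 18 / eps ^+ 2 + 12 * (12 / (1 - nu) ^+ 2 + 2 * (c + 1) / (1 - nu)) / eps.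
near=> n.
have n1 : (1 < n)%N by near: n; exact: nbhs_infty_gt.
have [k1 k2] : kappa * p n * n%:R <= nu /\ p n * n%:R <= c by near: n.
apply: le_trans (prob_modularity_low n1 (p01 n) k01 k1 nu1 k2 e01) _.
have K0 : 0 <= K.
  have /andP[e0 _] := e01; have /andP[p0 _] := p01 n.
  have c0 : 0 <= c by apply: le_trans k2; rewrite mulr_ge0 // ltW.
  have nu0 : 0 < 1 - nu by rewrite subr_gt0.
  apply: addr_ge0; first by rewrite divr_ge0 // sqr_ge0.
  apply: divr_ge0; last exact: ltW.
  apply: mulr_ge0 => //; apply: addr_ge0; first by rewrite divr_ge0 // sqr_ge0.
  by rewrite divr_ge0 ?(ltW nu0) //; lra.
have h : (4 * K) / (n%:R ^+ 2 * p n) <= del by near: n; exact: near_div_le.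
apply: le_trans h; have /andP[p0 _] := p01 n.
have n2 : 2 <= n%:R :> R by rewrite ler_nat.
have nn : 0 < n%:R ^+ 2 * p n by rewrite mulr_gt0 // exprn_gt0 //; lra.
have C4 : n%:R ^+ 2 * p n / 4 <= p n * 'C(n, 2)%:R.
  have := bin2_dbl R n => e.
  have -> : 'C(n, 2)%:R = n%:R * (n%:R - 1) / 2 :> R by lra.
  have -> : n%:R ^+ 2 * p n / 4 = p n * (n%:R ^+ 2 / 4) by ring.
  by rewrite ler_wpM2l ?(ltW p0) //; nra.
rewrite -/K mulrC [4 * K]mulrC -mulrA [leLHS]mulrC ler_wpM2l //.
have -> : 4 / (n%:R ^+ 2 * p n) = (n%:R ^+ 2 * p n / 4)^-1 by rewrite invf_div.
have q0 : 0 < n%:R ^+ 2 * p n / 4 by rewrite divr_gt0.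
by rewrite lef_pV2 ?posrE // (lt_le_trans q0).
Unshelve. all: by end_near. Qed.

(** Since [n * p] is bounded, [p <= 1/2] eventually. The exponential term is reduced to order
    [1 / n] by [expR (- x) <= 1 / x]. *)
Lemma negligible_high (p : nat -> R) (s c1 t r : R) :
  t = s / (3 * (1 + s)) -> r = t ^+ 3 / (8 * c1) -> 0 < s ->
  (forall n, 0 < p n <= 1) ->
  (\forall n \near \oo, 1 + s <= n%:R * p n <= c1) ->
  negligible p (fun n G => 1 - r ^+ 2 < modularity R G).
Proof.
move=> tE rE s0 p01 pc eps e0.
have t0 : 0 < t by rewrite tE divr_gt0 // mulr_gt0 //; lra.
near=> n.
have n1 : (1 < n)%N by near: n; exact: nbhs_infty_gt.
have n0 : 0 < n%:R :> R by rewrite ltr0n ltnW.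
have /andP[c0n c1n] : 1 + s <= n%:R * p n <= c1 by near: n.
have /andP[p0 p1] := p01 n.
have p2 : p n <= 2^-1.
  have h : c1 * 2 <= n%:R by near: n; exact: nbhs_infty_ger.
  have : n%:R * p n <= n%:R * 2^-1 by apply: le_trans c1n _; lra.
  by rewrite ler_pM2l.
rewrite mulrC in c0n; rewrite mulrC in c1n.
apply: le_trans (prob_modularity_high tE rE n1 s0 (ltW p0) p2 c0n c1n) _.
have c10 : 0 < c1 by lra.
have h : (2 / c1 + expR t * (4 / t ^+ 3)) / n%:R <= eps.
  by near: n; apply: near_div_le => //; exact: cvg_natr_pinfty.
apply: le_trans h; rewrite [leRHS]mulrDl; apply: lerD; first by rewrite invfM mulrA.
rewrite expRD -[leRHS]mulrA ler_wpM2l ?expR_ge0 // expRN.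
have x0 : 0 < t ^+ 3 / 4 * n%:R by rewrite !mulr_gt0 ?exprn_gt0 // invr_gt0.
have -> : 4 / t ^+ 3 / n%:R = (t ^+ 3 / 4 * n%:R)^-1 by field; rewrite !gt_eqF.
rewrite lef_pV2 ?posrE ?expR_gt0 //.
by have := expR_ge1Dx (t ^+ 3 / 4 * n%:R); lra.
Unshelve. all: by end_near. Qed.

Lemma negligible_dense (p : nat -> R) (eta : R) : 0 < eta <= 4^-1 ->
  (forall n, 0 < p n <= 1) -> (fun n => n%:R * p n) @ \oo --> +oo ->
  negligible p (fun n G => 12 * eta < modularity R G).
Proof.
move=> e01 p01 npy eps eps0; have /andP[e0 _] := e01; near=> n.
have n1 : (1 < n)%N by near: n; exact: nbhs_infty_gt.
have h1 : 1 <= eta * n%:R.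
  have : 1 / eta <= n%:R by near: n; exact: nbhs_infty_ger.
  by rewrite ler_pdivrMr // mulrC.
have h2 : 32 <= eta ^+ 2 * (n%:R * p n).
  have : 32 / eta ^+ 2 <= n%:R * p n by near: n; move/cvgryPge: npy; exact.
  by rewrite ler_pdivrMr ?exprn_gt0 // mulrC.
apply: le_trans (prob_modularity_dense n1 (p01 n) e01 h1 h2) _.
have h : 2 / n%:R <= eps by near: n; apply: near_div_le => //; exact: cvg_natr_pinfty.
by apply: le_trans h; lra.
Unshelve. all: by end_near. Qed.

End Limits.

Theorem theorem1p1 (R : realType) :
  (* (a) *)
  (forall p : nat -> R,
     (forall n, 0 < p n <= 1) ->
     (fun n => n%:R ^+ 2 * p n) @ \oo --> +oo ->
     (exists u : nat -> R,
        u @ \oo --> (0 : R) /\ \forall n \near \oo, n%:R * p n <= 1 + u n) ->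
     cvg_in_prob p (fun n G => modularity R G) 1)
  /\
  (* (b) *)
  (forall c0 c1 : R, 1 < c0 -> c0 <= c1 ->
     exists2 delta : R, 0 < delta &
       forall p : nat -> R,
         (forall n, 0 < p n <= 1) ->
         (\forall n \near \oo, c0 <= n%:R * p n <= c1) ->
         whp p (fun n G => delta < modularity R G < 1 - delta))
  /\
  (* (c) *)
  (forall p : nat -> R,
     (forall n, 0 < p n <= 1) ->
     (fun n => n%:R * p n) @ \oo --> +oo ->
     cvg_in_prob p (fun n G => modularity R G) 0).
Proof.
split; [|split].
- move=> p p01 n2p [u [u0 npu]] eps e0.
  pose e := Num.min eps 1 / 2.
  have me : 0 < Num.min eps 1 <= 1 by rewrite lt_min e0 ltr01 ge_min lexx orbT.
  have mle : Num.min eps 1 <= eps by rewrite ge_min lexx.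
  have /andP[m0 m1] := me.
  have low : negligible p (fun n G => modularity R G < (1 - e / 2) - e / 2).
    (* Once [n * p <= 1 + e / 4], the subgraph has mean degree at most
       [(1 - e / 2) * (1 + e / 4) <= 1 - e / 4], so it is subcritical. *)
    apply: (@negligible_low _ p (1 - e / 2) (1 - e / 4) 2) => //.
    + by rewrite /e; lra.
    + by rewrite /e; lra.
    + by rewrite /e; lra.
    near=> n.
    have un : u n <= e / 4.
      near: n; have /cvgrPdist_le/(_ (e / 4)) := u0.
      have e40 : 0 < e / 4 by rewrite /e; lra.
      move=> /(_ e40); apply: filterS => n; rewrite sub0r normrN.
      exact/le_trans/ler_norm.
    have pn : n%:R * p n <= 1 + u n by near: n.
    have pe : n%:R * p n <= 1 + e / 4 by lra.
    rewrite -mulrA [p n * _]mulrC; split; last by rewrite /e in pe *; lra.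
    apply: le_trans (ler_wpM2l _ pe) _; first by rewrite /e; lra.
    by have := sqr_ge0 e; lra.
  (* Modularity never exceeds 1, so low modularity is the only bad event and fills both slots. *)
  apply: (whp_negligible p01 _ low low); near=> n => G.
  have n0 : (0 < #|'I_n|)%N by rewrite card_ord; near: n; exact: nbhs_infty_gt.
  rewrite -leNgt ler0_norm ?subr_le0 ?modularity_le1 // => h.
  by apply/orP; left; rewrite /e; lra.
- move=> c0 c1 c01 c0c1.
  pose s := c0 - 1; pose t := s / (3 * (1 + s)); pose r := t ^+ 3 / (8 * c1).
  (* With this proportion the subgraph has mean degree at most 1/2. *)
  pose k := (2 * c1)^-1.
  have s0 : 0 < s by rewrite subr_gt0.
  have t0 : 0 < t by rewrite divr_gt0 // mulr_gt0 //; lra.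
  have r0 : 0 < r by rewrite divr_gt0 ?exprn_gt0 // mulr_gt0 //; lra.
  have k0 : 0 < k by rewrite invr_gt0; lra.
  have kc : k * c1 = 2^-1 by rewrite /k; field; lra.
  have k1 : k < 1 by nra.
  have r2 : 0 < r ^+ 2 by rewrite exprn_gt0.
  (* Half of each of the margins [k / 2] and [r ^+ 2], so that failure of a strict inequality in the
     conclusion falls strictly inside a bad event. *)
  have d0 : 0 < Num.min (k / 4) (r ^+ 2 / 2) by rewrite lt_min !divr_gt0.
  exists (Num.min (k / 4) (r ^+ 2 / 2)) => // p p01 pc.
  have d1 : Num.min (k / 4) (r ^+ 2 / 2) <= k / 4 by rewrite ge_min lexx.
  have d2 : Num.min (k / 4) (r ^+ 2 / 2) <= r ^+ 2 / 2 by rewrite ge_min lexx orbT.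
  have n2p : (fun n => n%:R ^+ 2 * p n) @ \oo --> +oo.
    apply/cvgryPge => A; near=> n.
    have nA : A <= n%:R by near: n; exact: nbhs_infty_ger.
    have /andP[c0n _] : c0 <= n%:R * p n <= c1 by near: n.
    apply: le_trans nA _; rewrite expr2 -mulrA ler_peMr //; lra.
  have low : negligible p (fun n G => modularity R G < k - k / 2).
    apply: (@negligible_low _ p k 2^-1 c1) => //.
    + by rewrite k0.
    + lra.
    + lra.
    near=> n.
    have /andP[_ c1n] : c0 <= n%:R * p n <= c1 by near: n.
    rewrite -mulrA [p n * _]mulrC; split=> //.
    by rewrite -kc ler_wpM2l // ltW.
  have high : negligible p (fun n G => 1 - r ^+ 2 < modularity R G).
    apply: (@negligible_high _ p s c1 t r) => //.
    by apply: filterS pc => n; rewrite /s addrC subrK.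
  apply: (whp_negligible p01 _ low high); near=> n => G.
  rewrite negb_and -!leNgt => /orP[h|h]; apply/orP; [left|right]; lra.
- move=> p p01 npy eps e0.
  have me : 0 < Num.min eps 1 <= 1 by rewrite lt_min e0 ltr01 ge_min lexx orbT.
  have mle : Num.min eps 1 <= eps by rewrite ge_min lexx.
  have /andP[m0 m1] := me.
  (* The threshold is half of the capped [eps], hence strictly below [eps]; the cap keeps the
     parameter below 1/4. *)
  have dense : negligible p (fun n G => 12 * (Num.min eps 1 / 24) < modularity R G).
    by apply: negligible_dense => //; lra.
  apply: (whp_negligible p01 _ dense dense); near=> n => G.
  have n0 : (0 < #|'I_n|)%N by rewrite card_ord; near: n; exact: nbhs_infty_gt.
  rewrite -leNgt subr0 ger0_norm ?modularity_ge0 // => h.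
  by apply/orP; left; lra.
Unshelve. all: by end_near. Qed.
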